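(* Let $\mathcal{M}$ be a $\sigma$-finite type $\mathrm{II}_\infty$ factor, and let $\mathcal{B}\subseteq\mathcal{M}$ be a (unital) von Neumann subfactor which is also of type $\mathrm{II}_\infty$. Then $$W^*(\mathcal{N}_{\mathcal{M}}(\mathcal{B}))=W^*(\mathcal{GN}_{\mathcal{M}}(\mathcal{B}))=W^*(\mathcal{UN}_{\mathcal{M}}(\mathcal{B})).$$ Consequently, $\mathcal{B}$ is regular in $\mathcal{M}$ if and only if it is unitary regular in $\mathcal{M}$.
   Context: For a unital inclusion of von Neumann algebras $\mathcal{B}\subseteq\mathcal{M}$ (i.e. $1_{\mathcal{B}}=1_{\mathcal{M}}$), put $\mathcal{N}_{\mathcal{M}}(\mathcal{B})=\{n\in\mathcal{M}: n\mathcal{B}n^*\cup n^*\mathcal{B}n\subseteq\mathcal{B}\}$ (normaliser), $\mathcal{GN}_{\mathcal{M}}(\mathcal{B})=\{v\in\mathcal{N}_{\mathcal{M}}(\mathcal{B}): vv^*v=v\}$ (groupoid normaliser), and $\mathcal{UN}_{\mathcal{M}}(\mathcal{B})=\{u\in\mathcal{M}\text{ unitary}: u\mathcal{B}u^*=\mathcal{B}\}$ (unitary normaliser). $W^*(S)$ denotes the von Neumann subalgebra of $\mathcal{M}$ generated by $S$. $\mathcal{B}$ is regular in $\mathcal{M}$ if $W^*(\mathcal{N}_{\mathcal{M}}(\mathcal{B}))=\mathcal{M}$ and unitary regular in $\mathcal{M}$ if $W^*(\mathcal{UN}_{\mathcal{M}}(\mathcal{B}))=\mathcal{M}$. *)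

(* Defs.v *)
From mathcomp Require Import all_boot all_order all_algebra.
From mathcomp Require Import complex.
From mathcomp Require Import all_classical all_reals all_analysis.

Set Implicit Arguments.
Unset Strict Implicit.
Unset Printing Implicit Defensive.

Import Order.TTheory GRing.Theory Num.Theory.
Import numFieldNormedType.Exports.

Local Open Scope classical_set_scope.
Local Open Scope ring_scope.
Local Open Scope complex_scope.

(* Complex Hilbert spaces, of arbitrary dimension: complete normed spaces whose
   norm comes from an inner product (linear in its first argument). *)
Record hilbertType (R : realType) := Hilbert {
  hilbert_sort :> completeNormedModType R[i];
  dotp : {dot hilbert_sort for (Num.conj : R[i] -> R[i])};
  norm_dotp : forall x : hilbert_sort, `|x| ^+ 2 = dotp x x }.

Section Operators.
Context {R : realType} {H : hilbertType R}.
Implicit Types (S T U : H -> H) (A B M : set (H -> H)).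

(* B(H); operators are plain functions, so that equality of operators is
   equality of functions and their product is composition. *)
Definition bounded_op : set (H -> H) := [set T | linear T /\ continuous T].

Definition is_adjoint T S := forall x y : H, dotp H (T x) y = dotp H x (S y).

(* The adjoint of a bounded operator exists and is unique by the Riesz
   representation theorem; the default value 0 is for unbounded T only. *)
Definition adj T : H -> H :=
  xget (cst 0) [set S | bounded_op S /\ is_adjoint T S].

Definition commutant A : set (H -> H) :=
  [set T | bounded_op T /\ forall S, A S -> T \o S = S \o T].

Definition star_subalgebra A :=
  [/\ A `<=` bounded_op,
      forall S T, A S -> A T -> A (S \+ T),
      forall (c : R[i]) T, A T -> A (c \*: T),
      forall S T, A S -> A T -> A (S \o T) &
      forall T, A T -> A (adj T)].

(* Von Neumann algebras on H, always with unit id. *)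
Definition von_neumann A :=
  [/\ star_subalgebra A, A id & commutant (commutant A) = A].

(* W*(S), for a subset S of M: the smallest von Neumann subalgebra of M
   containing S. *)
Definition Wstar M (S : set (H -> H)) : set (H -> H) :=
  smallest [set A | von_neumann A /\ A `<=` M] S.

Definition vN_center M : set (H -> H) := M `&` commutant M.

(* The zero algebra (on the zero space) is not a factor. *)
Definition vN_factor M :=
  [/\ von_neumann M,
      vN_center M = [set c \*: id | c in [set: R[i]]] &
      (id : H -> H) <> cst 0].

Definition projection M : set (H -> H) :=
  [set p | [/\ M p, p \o p = p & adj p = p]].

(* For projections: the range of q is contained in that of p. *)
Definition proj_le (q p : H -> H) := p \o q = q.

Definition proj_orth (p q : H -> H) := p \o q = cst 0.

(* Murray-von Neumann equivalence in M. *)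
Definition mvn_equiv M (p q : H -> H) :=
  exists v, [/\ M v, adj v \o v = p & v \o adj v = q].

Definition finite_proj M (p : H -> H) :=
  projection M p /\
  forall q, projection M q -> proj_le q p -> mvn_equiv M p q -> q = p.

(* pMp is commutative. *)
Definition abelian_proj M (p : H -> H) :=
  projection M p /\
  forall S T, M S -> M T ->
    (p \o S \o p) \o (p \o T \o p) = (p \o T \o p) \o (p \o S \o p).

Definition type_II M :=
  (forall p, abelian_proj M p -> p = cst 0) /\
  (forall z, projection M z -> vN_center M z -> z <> cst 0 ->
     exists p, [/\ finite_proj M p, proj_le p z & p <> cst 0]).

Definition type_II_infty M :=
  type_II M /\ forall z, finite_proj M z -> vN_center M z -> z = cst 0.

Definition sigma_finite_vN M :=
  forall F : set (H -> H),
    F `<=` projection M ->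
    (forall p, F p -> p <> cst 0) ->
    (forall p q, F p -> F q -> p <> q -> proj_orth p q) ->
    countable F.

Definition normaliser M B : set (H -> H) :=
  [set n | M n /\
     [set n \o b \o adj n | b in B] `|` [set adj n \o b \o n | b in B] `<=` B].

Definition groupoid_normaliser M B : set (H -> H) :=
  [set v | normaliser M B v /\ v \o adj v \o v = v].

Definition unitary_in M (u : H -> H) :=
  [/\ M u, adj u \o u = id & u \o adj u = id].

Definition unitary_normaliser M B : set (H -> H) :=
  [set u | unitary_in M u /\ [set u \o b \o adj u | b in B] = B].

Definition regular_in M B := Wstar M (normaliser M B) = M.

Definition unitary_regular_in M B := Wstar M (unitary_normaliser M B) = M.

End Operators.

(* Main.v *)
From HB Require Import structures.
Require Import Defs.
From mathcomp Require Import all_boot all_order all_algebra.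
From mathcomp Require Import complex.
From mathcomp Require Import all_classical all_reals all_analysis.
From mathcomp Require Import lra ring.

Set Implicit Arguments.
Unset Strict Implicit.
Unset Printing Implicit Defensive.

Import Order.TTheory GRing.Theory Num.Theory.
Import numFieldNormedType.Exports.

Local Open Scope classical_set_scope.
Local Open Scope ring_scope.
Local Open Scope complex_scope.

(** W^*(S) is the intersection of the von Neumann algebras A between S and M,
    so the theorem says that such an A contains every normaliser n of B as
    soon as it contains the unitary normalisers.

    The unitaries of B normalise B, and a self-adjoint contraction b is the
    mean of the unitaries b + i c and b - i c, where c^2 = 1 - b^2. Hence B is
    contained in A ([vn_generated_by_unitaries]).

    Let n = v h be the polar decomposition, h^2 = n^* n. As n^* n is in B, so is
    h. The partial isometry v normalises B again, because the products
    n n^* (v b v^* ) n n^* = n (h b h) n^* and h (v^* b v) h = n^* b n are in B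
    and the outer factors can be cancelled ([vn_sandwich],
    [polar_groupoid_normaliser]). It remains to see that v is in A.

    For this v has to be enlarged to a unitary. B is infinite, so it contains
    isometries T_0, T_1, ... with pairwise orthogonal ranges
    ([isometry_sequence]). The strong sum S of the T_k v T_k^* is a groupoid
    normaliser of B whose corner T_0^* S T_0 is v. The gain is that the initial
    and final projections of S are both equivalent to 1 in B, whether v^* v is
    finite or infinite. Indeed, as B is a sigma-finite factor, there are
    countably many y_k in B with y_k^* y_k below p = v^* v and with ranges
    whose orthogonal sum is H ([exhausting_partial_isometries]); the sum of the
    T_k y_k^* is an isometry in B with range below S^* S, and the
    Cantor-Bernstein argument turns it into u in B with u^* u = 1 and
    u u^* = S^* S ([amplified_support]). Let w in B do the same for S S^*. Then
    U = w^* S u is a unitary normaliser of B, and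
    v = T_0^* S T_0 = T_0^* w U u^* T_0 is in A
    ([groupoid_normaliser_generated]). *)

(** * The real part of the inner product *)

Section RealStructure.
Context {R : realType} {H : hilbertType R}.
Implicit Types (x y z : H) (T S : H -> H).

(** Estimates are made with real parts, because R is totally ordered and R[i] is
    not. No information is lost: the imaginary part of the inner product of x
    and y is the real part of that of x and i y ([Re_Im_dotp]). *)
Definition rdot x y : R := complex.Re (dotp H x y).
Definition nrm x : R := complex.Re `|x|.

Lemma nrmC x : `|x| = (nrm x)%:C.
Proof.
have /ger0_Im : 0 <= `|x| by exact: normr_ge0.
by rewrite /nrm; case: `|x| => a b /= ->.
Qed.

Lemma nrm_ge0 x : 0 <= nrm x.
Proof. by rewrite -ler0c -nrmC normr_ge0. Qed.

Lemma nrm_eq0 x : nrm x = 0 -> x = 0.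
Proof. by move=> x0; apply: normr0_eq0; rewrite nrmC x0. Qed.

Lemma nrm0 : nrm 0 = 0.
Proof. by rewrite /nrm normr0. Qed.

Lemma nrmD x y : nrm (x + y) <= nrm x + nrm y.
Proof. by rewrite -lecR rmorphD /= -!nrmC ler_normD. Qed.

Lemma nrmN x : nrm (- x) = nrm x.
Proof. by rewrite /nrm normrN. Qed.

Lemma nrmBC x y : nrm (x - y) = nrm (y - x).
Proof. by rewrite -nrmN opprB. Qed.

Lemma rdotC x y : rdot x y = rdot y x.
Proof.
have ReJ (c : R[i]) : complex.Re (Num.conj c) = complex.Re c by case: c.
by rewrite /rdot hermC expr0 mul1r; exact: ReJ.
Qed.

Lemma rdotDl x y z : rdot (x + y) z = rdot x z + rdot y z.
Proof.
have ReD (a b : R[i]) : complex.Re (a + b) = complex.Re a + complex.Re b.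
  by case: a; case: b.
by rewrite /rdot linearDl; exact: ReD.
Qed.

Lemma rdotZ (c : R[i]) x y : rdot (c *: x) y = rdot x (c^* *: y).
Proof.
have cK : Num.conj (c^*) = c by exact: conjcK.
by rewrite /rdot linearZl_LR linearZr_LR /= cK.
Qed.

Lemma rdotRl (r : R) x y : rdot (r%:C *: x) y = r * rdot x y.
Proof.
have ReM (c : R[i]) : complex.Re (r%:C * c) = r * complex.Re c.
  by case: c => a b /=; rewrite mul0r subr0.
by rewrite /rdot linearZl_LR; exact: ReM.
Qed.

Lemma rdotxx x : rdot x x = nrm x ^+ 2.
Proof.
by rewrite /rdot -norm_dotp nrmC -rmorphXn.
Qed.

(** This lemma and [nrm_complete] translate continuity and completeness into
    inequalities between real numbers, and the topology of H is not referred to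
    after them. *)
Lemma bounded_opP T : bounded_op T <->
  linear T /\ exists C, forall x, nrm (T x) <= C * nrm x.
Proof.
split=> [[linT conT]|[linT [C TC]]]; split => //.
- pose f : {linear H -> H} := HB.pack T (GRing.isLinear.Build _ _ _ _ T linT).
  have /linear_boundedP : bounded_near f (nbhs (0 : H)).
    exact/continuous_linear_bounded/conT.
  move=> /pinfty_ex_gt0[r r0 Tr]; exists (complex.Re r) => x.
  have := Tr x; rewrite !nrmC -[in X in X -> _](RRe_real (gtr0_real r0)).
  by rewrite -rmorphM lecR.
- pose f : {linear H -> H} := HB.pack T (GRing.isLinear.Build _ _ _ _ T linT).
  apply: (@bounded_linear_continuous _ _ _ f); apply/linear_boundedP.
  near=> r => x; apply: (@le_trans _ _ (C%:C * `|x|)).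
    by rewrite !nrmC -rmorphM lecR.
  rewrite ler_wpM2r//; near: r; apply: nbhs_pinfty_ge.
  exact/complex_realP/ex_intro.
Unshelve. all: by end_near. Qed.

Lemma nrm_complete (u : nat -> H) :
  (forall e : R, 0 < e -> exists N, forall m n, (N <= m)%N -> (N <= n)%N ->
    nrm (u m - u n) < e) ->
  exists l, forall e : R, 0 < e -> exists N, forall n, (N <= n)%N ->
    nrm (u n - l) < e.
Proof.
move=> cu.
have posC (e : R[i]) : 0 < e -> 0 < complex.Re e /\ e = (complex.Re e)%:C.
  by move=> e0; rewrite -ltcR (RRe_real (gtr0_real e0)).
have : cvg (u @ \oo).
  suff : cauchy (u @ \oo) by exact: cauchy_cvg.
  suff : cauchy_ex (u @ \oo) by exact: cauchy_exP.
  move=> e /posC[e0 ->]; rewrite /fmapE -ball_normE /ball_.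
  have [N uN] := cu _ e0; exists (u N), N => // n /= Nn.
  by rewrite nrmC ltcR uN.
rewrite cvg_ex => -[l /= /cvgrPdist_lt ul]; exists l => e e0.
have eC : 0 < e%:C by rewrite ltcR.
have [N _ uN] := ul _ eC.
by exists N => n /uN /=; rewrite nrmC ltcR nrmBC.
Qed.

End RealStructure.

(** * Orthogonal projection and the Riesz representation *)

Section HilbertGeometry.
Context {R : realType} {H : hilbertType R}.
Implicit Types (x y z w : H) (T S : H -> H) (L : set H).

Lemma rdotDr x y z : rdot x (y + z) = rdot x y + rdot x z.
Proof. by rewrite rdotC rdotDl !(rdotC x). Qed.

Lemma rdotRr (r : R) x y : rdot x (r%:C *: y) = r * rdot x y.
Proof. by rewrite rdotC rdotRl rdotC. Qed.

Lemma rdotNl x y : rdot (- x) y = - rdot x y.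
Proof.
by rewrite -scaleN1r -[-1](rmorphN1 (real_complex R)) rdotRl mulN1r.
Qed.

Lemma rdotNr x y : rdot x (- y) = - rdot x y.
Proof. by rewrite rdotC rdotNl rdotC. Qed.

Lemma rdotBl x y z : rdot (x - y) z = rdot x z - rdot y z.
Proof. by rewrite rdotDl rdotNl. Qed.

Lemma rdotBr x y z : rdot x (y - z) = rdot x y - rdot x z.
Proof. by rewrite rdotDr rdotNr. Qed.

Lemma rdot0l x : rdot 0 x = 0.
Proof. by rewrite -(subrr x) rdotBl subrr. Qed.

Lemma rdot0r x : rdot x 0 = 0.
Proof. by rewrite rdotC rdot0l. Qed.

Lemma rdot_eq0 x : rdot x x = 0 -> x = 0.
Proof. by rewrite rdotxx => /eqP; rewrite sqrf_eq0 => /eqP/nrm_eq0. Qed.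

Lemma rdot_inj x y : (forall z, rdot x z = rdot y z) -> x = y.
Proof.
move=> xy; apply/eqP; rewrite -subr_eq0; apply/eqP/rdot_eq0.
by rewrite rdotBl xy subrr.
Qed.

Lemma nrmD2 x y : nrm (x + y) ^+ 2 = nrm x ^+ 2 + nrm y ^+ 2 + 2 * rdot x y.
Proof. by rewrite -!rdotxx !rdotDl !rdotDr (rdotC y x); ring. Qed.

Lemma nrmB2 x y : nrm (x - y) ^+ 2 = nrm x ^+ 2 + nrm y ^+ 2 - 2 * rdot x y.
Proof. by rewrite nrmD2 nrmN rdotNr; ring. Qed.

Lemma nrmR (r : R) x : nrm (r%:C *: x) ^+ 2 = r ^+ 2 * nrm x ^+ 2.
Proof. by rewrite -!rdotxx rdotRl rdotRr; ring. Qed.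

Lemma rdot_le x y : rdot x y <= nrm x * nrm y.
Proof.
have := nrmD2 x y; have := nrmD x y; have := nrm_ge0 (x + y).
have := nrm_ge0 x; have := nrm_ge0 y; nra.
Qed.

Lemma rdot_le_norm x y : `|rdot x y| <= nrm x * nrm y.
Proof. by rewrite ler_norml rdot_le andbT lerNl -rdotNl -(nrmN x) rdot_le. Qed.

(** Only real scalars are required, so that the kernel of a real functional is
    covered, as the proof of [riesz] needs. *)
Definition closed_subspace L :=
  [/\ L 0, forall x y, L x -> L y -> L (x + y),
      forall (r : R) x, L x -> L (r%:C *: x) &
      forall x, (forall e : R, 0 < e -> exists2 y, L y & nrm (x - y) < e) ->
        L x].

Lemma inv_small (e : R) : 0 < e ->
  exists N, forall n, (N <= n)%N -> n.+1%:R^-1 < e.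
Proof.
move=> e0; exists (Num.truncn e^-1) => n Nn.
rewrite -[e]invrK ltf_pV2 ?posrE ?invr_gt0//.
by apply: (lt_le_trans (truncnS_gt _)); rewrite ler_nat.
Qed.

(** For r = rdot w y and small s > 0, moving from w to w - (r s) y would
    decrease the norm unless r = 0. *)
Lemma nearest_orth L w : closed_subspace L ->
  (forall y, L y -> nrm w <= nrm (w - y)) -> forall y, L y -> rdot w y = 0.
Proof.
move=> [_ _ LZ _] wmin y Ly.
pose Y := nrm y ^+ 2; pose r := rdot w y; pose s := (Y + 1)^-1.
have Y0 : 0 <= Y by rewrite sqr_ge0.
have s0 : 0 < s by rewrite invr_gt0; lra.
have sY : s * Y = 1 - s by rewrite /s; field; lra.
have := wmin _ (LZ (r * s) _ Ly); rewrite -ler_sqr ?nnegrE ?nrm_ge0//.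
rewrite nrmB2 nrmR rdotRr -/Y -/r => h.
have {}h : 0 <= r ^+ 2 * s * (s * Y - 2) by nra.
have : r ^+ 2 = 0.
  rewrite sY in h; have := sqr_ge0 r => r2.
  have : 0 <= r ^+ 2 * s by rewrite mulr_ge0// ltW.
  nra.
by move=> /eqP; rewrite sqrf_eq0 => /eqP.
Qed.

(** By the parallelogram law a sequence in L that minimises the distance to z is
    Cauchy. *)
Lemma exists_projection L z : closed_subspace L ->
  exists2 k, L k & forall y, L y -> rdot (z - k) y = 0.
Proof.
move=> cL; have [L0 LD LZ Lc] := cL.
pose E := [set nrm (z - y) ^+ 2 | y in L].
have hE : has_inf E.
  split; first by exists (nrm (z - 0) ^+ 2), 0.
  by exists 0 => _ [y _ <-]; exact: sqr_ge0.
have dE y : L y -> inf E <= nrm (z - y) ^+ 2.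
  by move=> Ly; apply: ge_inf; [exact: hE.2|exists y].
have /choice[k kP] (n : nat) :
    exists y, L y /\ nrm (z - y) ^+ 2 < inf E + n.+1%:R^-1.
  have n0 : 0 < n.+1%:R^-1 :> R by rewrite invr_gt0.
  by have [_ [y Ly <-] yE] := inf_adherent n0 hE; exists y.
have [|l lP] := @nrm_complete _ _ k.
  move=> e e0; have [|N NP] := inv_small (e := e ^+ 2 / 4);
    first by rewrite divr_gt0// exprn_gt0.
  exists N => m n /NP Nm /NP Nn.
  have [Lm km] := kP m; have [Ln kn] := kP n.
  have := dE _ (LZ 2^-1 _ (LD _ _ Lm Ln)).
  set mid := z - _ => dmid.
  have mid2 : nrm (z - k m + (z - k n)) ^+ 2 = 4 * nrm mid ^+ 2.
    rewrite (_ : _ + _ = 2%:C *: mid) ?nrmR ?expr2; first by ring.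
    rewrite /mid scalerBr scalerA -rmorphM mulfV// scale1r.
    by rewrite -[2](natrD _ 1 1) rmorphD /= scalerDl scale1r addrACA opprD.
  have par : nrm (k m - k n) ^+ 2 =
      2 * nrm (z - k m) ^+ 2 + 2 * nrm (z - k n) ^+ 2 - 4 * nrm mid ^+ 2.
    rewrite -mid2 [nrm (z - k m + _) ^+ 2]nrmD2.
    rewrite (_ : k m - k n = (z - k n) - (z - k m)).
      by rewrite nrmB2 (rdotC (z - k n)); ring.
    by rewrite opprB [RHS]addrC addrA subrK.
  rewrite -ltr_sqr ?nnegrE ?nrm_ge0 ?ltW// par.
  by move: (m.+1%:R^-1) (n.+1%:R^-1) km kn Nm Nn => a b *; lra.
have Ll : L l.
  apply: Lc => e /lP[N /(_ N (leqnn _)) Nl].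
  exists (k N); first by case: (kP N).
  by rewrite nrmBC.
exists l => //; apply: (nearest_orth cL) => y Ly.
rewrite leNgt; apply/negP => ylt.
pose e := (nrm (z - l) - nrm (z - l - y)) / 2.
have e0 : 0 < e by rewrite divr_gt0// subr_gt0.
have [N lN] := lP _ e0.
have [|N' dN'] := inv_small (e := e ^+ 2); first by rewrite exprn_gt0.
pose n := maxn N N'.
have kl := lN n (leq_maxl _ _); have kd := dN' n (leq_maxr _ _).
have [_ kn] := kP n; have := dE _ (LD _ _ Ll Ly).
rewrite opprD addrA => dy.
have tri : nrm (z - l) <= nrm (z - k n) + nrm (k n - l).
  by apply: le_trans (nrmD _ _); rewrite addrA subrK.
have := nrm_ge0 (z - l - y).
have : nrm (z - l - y) + e < nrm (z - k n) by rewrite /e; rewrite /e in kl; lra.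
move: (nrm (z - k n)) (nrm (z - l - y)) (n.+1%:R^-1) kn kd dy.
move=> a b c kn kd dy ab b0.
nra.
Qed.

(** A vector orthogonal to the kernel of f represents f after scaling. *)
Lemma riesz (f : H -> R) : (forall x y, f (x + y) = f x + f y) ->
  (forall (r : R) x, f (r%:C *: x) = r * f x) ->
  (exists C, forall x, f x <= C * nrm x) ->
  exists w, forall x, f x = rdot x w.
Proof.
move=> fD fZ [C fC].
have fN x : f (- x) = - f x.
  by rewrite -scaleN1r -[-1](rmorphN1 (real_complex R)) fZ mulN1r.
have f0 : f 0 = 0 by have := fZ 0 0; rewrite mul0r scaler0.
pose D := `|C| + 1.
have D0 : 0 < D by rewrite ltr_pwDr.
have fD1 x : f x <= D * nrm x.
  apply: (le_trans (fC x)); rewrite ler_wpM2r ?nrm_ge0//.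
  by rewrite (le_trans (ler_norm _))// lerDl.
have fabs x : `|f x| <= D * nrm x.
  by rewrite ler_norml fD1 andbT lerNl -fN -(nrmN x) fD1.
have cK : closed_subspace [set x | f x = 0].
  split=> //= [x y fx fy|r x fx|x cx]; first by rewrite fD fx fy addr0.
    by rewrite fZ fx mulr0.
  apply/eqP; rewrite -normr_le0 leNgt; apply/negP => fx0.
  have [|y fy] := cx (`|f x| / D); first by rewrite divr_gt0.
  rewrite ltr_pdivlMr// mulrC => /(le_lt_trans (fabs _)).
  by rewrite fD fN fy oppr0 addr0 ltxx.
have [|] := pselect (exists x, f x <> 0); last first.
  move=> nf; exists 0 => x; rewrite rdot0r; apply: contrapT => fx.
  by apply: nf; exists x.
move=> [x0 fx0]; have [k /= fk kP] := exists_projection x0 cK.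
pose w := x0 - k.
have fw : f w <> 0 by rewrite /w fD fN fk oppr0 addr0.
have w0 : rdot w w != 0.
  by apply/eqP => /rdot_eq0 w0; apply: fw; rewrite w0.
exists ((f w / rdot w w)%:C *: w) => x.
have /kP : [set x | f x = 0] (x - (f x / f w)%:C *: w).
  by rewrite /= fD fN fZ divfK ?subrr//; apply/eqP.
rewrite -/w rdotBr rdotRr (rdotC w) rdotRr => /eqP; rewrite subr_eq0 => /eqP ->.
by field; apply/andP; split; [exact/eqP|exact: w0].
Qed.
End HilbertGeometry.

(** * Bounded operators and their adjoints *)

Section Adjoints.
Context {R : realType} {H : hilbertType R}.
Implicit Types (x y z w : H) (T S : H -> H) (L : set H).

Section Linearity.
Variables (T : H -> H) (bT : bounded_op T).

Lemma bopD x y : T (x + y) = T x + T y.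
Proof. by case: bT => + _ => /(_ 1 x y); rewrite !scale1r. Qed.

Lemma bop0 : T 0 = 0.
Proof. by apply: (@addrI _ (T 0)); rewrite -bopD !addr0. Qed.

Lemma bopZ (c : R[i]) x : T (c *: x) = c *: T x.
Proof. by case: bT => + _ => /(_ c x 0); rewrite bop0 !addr0. Qed.

Lemma bopN x : T (- x) = - T x.
Proof. by rewrite -scaleN1r bopZ scaleN1r. Qed.

Lemma bopB x y : T (x - y) = T x - T y.
Proof. by rewrite bopD bopN. Qed.

Lemma bop_bound : exists2 C, 0 < C & forall x, nrm (T x) <= C * nrm x.
Proof.
case/bounded_opP: bT => _ [C TC]; exists (`|C| + 1); first by rewrite ltr_pwDr.
move=> x; apply: (le_trans (TC x)); rewrite ler_wpM2r ?nrm_ge0//.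
by rewrite (le_trans (ler_norm _))// lerDl.
Qed.

End Linearity.

Lemma bop_id : bounded_op (id : H -> H).
Proof. by apply/bounded_opP; split => //; exists 1 => x; rewrite mul1r. Qed.

Lemma bop_cst0 : bounded_op (cst 0 : H -> H).
Proof.
apply/bounded_opP; split => [c x y|]; first by rewrite /= scaler0 addr0.
by exists 0 => x; rewrite mul0r /= nrm0.
Qed.

Lemma bop_add S T : bounded_op S -> bounded_op T -> bounded_op (S \+ T).
Proof.
move=> bS bT; have [C C0 SC] := bop_bound bS; have [D D0 TD] := bop_bound bT.
apply/bounded_opP; split => [c x y|].
  by rewrite /= (bopD bS) (bopD bT) (bopZ bS) (bopZ bT) scalerDr addrACA.
by exists (C + D) => x; rewrite mulrDl (le_trans (nrmD _ _))// lerD.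
Qed.

Lemma bop_comp S T : bounded_op S -> bounded_op T -> bounded_op (S \o T).
Proof.
move=> bS bT; have [C C0 SC] := bop_bound bS; have [D D0 TD] := bop_bound bT.
apply/bounded_opP; split => [c x y|].
  by rewrite /= (bopD bT) (bopZ bT) (bopD bS) (bopZ bS).
exists (C * D) => x; rewrite (le_trans (SC _))// -mulrA ler_wpM2l// ltW//.
Qed.

Lemma nrmZ (c : R[i]) x : nrm (c *: x) = complex.Re `|c| * nrm x.
Proof.
by apply: complexI; rewrite -nrmC normrZ nrmC rmorphM /= RRe_real.
Qed.

Lemma nrmRpos (r : R) z : 0 <= r -> nrm (r%:C *: z) = r * nrm z.
Proof. by move=> r0; rewrite nrmZ ger0_norm// ler0c. Qed.

Lemma bop_scale c T : bounded_op T -> bounded_op (c \*: T).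
Proof.
move=> bT; have [C C0 TC] := bop_bound bT.
apply/bounded_opP; split => [d x y|].
  by rewrite /= (bopD bT) (bopZ bT) scalerDr !scalerA mulrC.
exists (complex.Re `|c| * C) => x; rewrite /= nrmZ -mulrA ler_wpM2l//.
by rewrite -ler0c RRe_real.
Qed.

Lemma Re_Im_dotp x y : dotp H x y = rdot x y +i* rdot x ('i%C *: y).
Proof.
have conji (c : R[i]) : complex.Re (Num.conj 'i%C * c) = complex.Im c.
  by case: c => a b /=; rewrite mul0r add0r mulN1r opprK.
apply/eqP; rewrite eq_complex eqxx /=; apply/eqP.
by rewrite /rdot linearZr_LR conji.
Qed.

Lemma is_adjointP T S : bounded_op T -> bounded_op S ->
  is_adjoint T S <-> forall x y, rdot (T x) y = rdot x (S y).
Proof.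
move=> bT bS; split=> [TS x y|TS x y]; first by rewrite /rdot TS.
by rewrite !Re_Im_dotp !TS (bopZ bS).
Qed.

Lemma adjoint_unique T S S' : (forall x y, rdot (T x) y = rdot x (S y)) ->
  (forall x y, rdot (T x) y = rdot x (S' y)) -> S = S'.
Proof.
move=> TS TS'; apply/funext => x; apply: rdot_inj => z.
by rewrite rdotC -TS TS' rdotC.
Qed.

(** Representing the real functionals x |-> rdot (T x) y is enough: the
    complex linearity of the adjoint follows from that of T by [rdotZ]. *)
Lemma adjoint_exists T : bounded_op T ->
  exists2 S, bounded_op S & forall x y, rdot (T x) y = rdot x (S y).
Proof.
move=> bT; have [C C0 TC] := bop_bound bT.
have /choice[S SP] (y : H) : exists w, forall x, rdot (T x) y = rdot x w.
  apply: (riesz (f := fun x => rdot (T x) y)) => [x x'|r x|].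
    by rewrite (bopD bT) rdotDl.
    by rewrite (bopZ bT) rdotRl.
  exists (C * nrm y) => x; apply: (le_trans (rdot_le _ _)).
  by rewrite mulrAC ler_wpM2r ?nrm_ge0.
exists S => //; apply/bounded_opP; split.
  move=> c x y; apply: rdot_inj => z; rewrite rdotC -SP rdotDr rdotDl.
  rewrite [rdot (T z) (c *: _)]rdotC !rdotZ -(bopZ bT) (rdotC x) !SP.
  by rewrite (rdotC _ (S x)) (rdotC z).
exists C => y; have [->|Sy0] := eqVneq (nrm (S y)) 0.
  by rewrite mulr_ge0 ?nrm_ge0 ?ltW.
have Sy : 0 < nrm (S y) by rewrite lt_neqAle eq_sym Sy0 nrm_ge0.
rewrite -(ler_pM2l Sy) -expr2 -rdotxx -SP (le_trans (rdot_le _ _))//.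
by rewrite mulrA ler_wpM2r ?nrm_ge0// mulrC TC.
Qed.

Lemma adj_spec T : bounded_op T ->
  bounded_op (adj T) /\ forall x y, rdot (T x) y = rdot x (adj T y).
Proof.
move=> bT; have [S bS TS] := adjoint_exists bT.
rewrite /adj; case: xgetP => [S' _ [bS' /(is_adjointP bT bS')]//|].
by move=> /(_ S)[]; split=> //; exact/is_adjointP.
Qed.

Lemma bop_adj T : bounded_op T -> bounded_op (adj T).
Proof. by case/adj_spec. Qed.

Lemma adjP T x y : bounded_op T -> rdot (T x) y = rdot x (adj T y).
Proof. by case/adj_spec => _ ->. Qed.

Lemma adjPr T x y : bounded_op T -> rdot x (T y) = rdot (adj T x) y.
Proof. by move=> bT; rewrite rdotC adjP// rdotC. Qed.

Lemma adj_eq T S : bounded_op T ->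
  (forall x y, rdot (T x) y = rdot x (S y)) -> adj T = S.
Proof. by move=> bT; apply: adjoint_unique => x y; rewrite adjP. Qed.

Lemma adjK T : bounded_op T -> adj (adj T) = T.
Proof.
by move=> bT; apply: adj_eq => [|x y]; rewrite ?adjPr//; exact: bop_adj.
Qed.

Lemma adj_comp S T : bounded_op S -> bounded_op T ->
  adj (S \o T) = adj T \o adj S.
Proof.
by move=> bS bT; apply: adj_eq => [|x y]; [exact: bop_comp|rewrite /= !adjP].
Qed.

Lemma adj_add S T : bounded_op S -> bounded_op T ->
  adj (S \+ T) = adj S \+ adj T.
Proof.
move=> bS bT; apply: adj_eq => [|x y]; first exact: bop_add.
by rewrite rdotDl rdotDr !adjP.
Qed.

Lemma adj_scale (c : R[i]) T : bounded_op T ->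
  adj (c \*: T) = Num.conj c \*: adj T.
Proof.
move=> bT; apply: adj_eq => [|x y]; first exact: bop_scale.
by rewrite /= rdotZ adjP// (bopZ (bop_adj bT)).
Qed.

Lemma adj_id : adj (id : H -> H) = id.
Proof. by apply: adj_eq => //; exact: bop_id. Qed.

Lemma adj_cst0 : adj (cst 0 : H -> H) = cst 0.
Proof.
by apply: adj_eq => [|x y]; [exact: bop_cst0|rewrite /= rdot0l rdot0r].
Qed.

End Adjoints.

(** * Pointwise limits and von Neumann algebras *)

Section VonNeumann.
Context {R : realType} {H : hilbertType R}.
Implicit Types (x y z w : H) (T S P : H -> H) (L : set H) (D : set (H -> H)).

Definition tends (u : nat -> H) l :=
  forall e : R, 0 < e -> exists N, forall n, (N <= n)%N -> nrm (u n - l) < e.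

Lemma small_eq0 x : (forall e : R, 0 < e -> nrm x < e) -> x = 0.
Proof.
move=> xe; apply/nrm_eq0/eqP; rewrite eq_le nrm_ge0 andbT leNgt.
by apply/negP => /xe; rewrite ltxx.
Qed.

Lemma tends_const l : tends (fun=> l) l.
Proof. by move=> e e0; exists 0 => n _; rewrite subrr nrm0. Qed.

Lemma tends_eventually (u u' : nat -> H) l N :
  (forall n, (N <= n)%N -> u n = u' n) -> tends u l -> tends u' l.
Proof.
move=> uu' ul e /ul[N' uN']; exists (maxn N N') => n.
by rewrite geq_max => /andP[/uu'<- /uN'].
Qed.

Lemma tends_dominated (u u' : nat -> H) l l' C :
  (forall n, nrm (u' n - l') <= C * nrm (u n - l)) -> tends u l -> tends u' l'.
Proof.
move=> uu' ul e e0; have C0 : 0 < `|C| + 1 by rewrite ltr_pwDr.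
have [|N uN] := ul (e / (`|C| + 1)); first by rewrite divr_gt0.
exists N => n /uN; rewrite ltr_pdivlMr// mulrC; apply: le_lt_trans.
rewrite (le_trans (uu' n))// ler_wpM2r ?nrm_ge0//.
by rewrite (le_trans (ler_norm _))// lerDl.
Qed.

Lemma tendsD (u u' : nat -> H) l l' : tends u l -> tends u' l' ->
  tends (fun n => u n + u' n) (l + l').
Proof.
move=> ul ul' e e0; have [|N uN] := ul (e / 2); first by rewrite divr_gt0.
have [|N' uN'] := ul' (e / 2); first by rewrite divr_gt0.
exists (maxn N N') => n; rewrite geq_max => /andP[/uN h /uN' h'].
rewrite opprD addrACA [e]splitr; apply: (le_lt_trans (nrmD _ _)); exact: ltrD.
Qed.

Lemma tends_bop T (u : nat -> H) l : bounded_op T -> tends u l ->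
  tends (fun n => T (u n)) (T l).
Proof.
move=> bT; have [C _ TC] := bop_bound bT.
by apply: (@tends_dominated _ _ _ _ C) => n; rewrite -(bopB bT).
Qed.

Lemma tendsZ (c : R[i]) (u : nat -> H) l : tends u l ->
  tends (fun n => c *: u n) (c *: l).
Proof. exact: (tends_bop (bop_scale c (@bop_id R H))). Qed.

Lemma tendsB (u u' : nat -> H) l l' : tends u l -> tends u' l' ->
  tends (fun n => u n - u' n) (l - l').
Proof.
move=> ul /(tendsZ (-1)) ul'; rewrite -scaleN1r.
have := tendsD ul ul'; apply: (@tends_eventually _ _ _ 0) => n _.
by rewrite scaleN1r.
Qed.

Lemma tends_unique (u : nat -> H) l l' : tends u l -> tends u l' -> l = l'.
Proof.
move=> ul /(tendsB ul) ul'; apply/eqP; rewrite -subr_eq0; apply/eqP/small_eq0.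
by move=> e /ul'[N /(_ N (leqnn _))]; rewrite subrr sub0r nrmN.
Qed.

Lemma tends_le (u : nat -> H) l (C : R) :
  (forall n, nrm (u n) <= C) -> tends u l -> nrm l <= C.
Proof.
move=> uC ul; rewrite leNgt; apply/negP => Cl.
have [|N /(_ N (leqnn _))] := ul (nrm l - C); first by rewrite subr_gt0.
rewrite nrmBC => h; have := nrmD (l - u N) (u N); rewrite subrK.
by have := uC N; lra.
Qed.

Lemma tends_nrm_le (u u' : nat -> H) l l' :
  (forall n, nrm (u n) <= nrm (u' n)) -> tends u l -> tends u' l' ->
  nrm l <= nrm l'.
Proof.
move=> uu' ul ul'; rewrite leNgt; apply/negP => ll'.
pose e := (nrm l - nrm l') / 2; have e0 : 0 < e by rewrite divr_gt0// subr_gt0.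
have [N uN] := ul _ e0; have [N' uN'] := ul' _ e0; pose n := maxn N N'.
have h := uN n (leq_maxl _ _); have h' := uN' n (leq_maxr _ _).
have := nrmD (l - u n) (u n); have := nrmD (u' n - l') l'.
by rewrite !subrK (nrmBC l); have := uu' n; rewrite /e in h h'; lra.
Qed.

Lemma tends_rdot_eq (u u' : nat -> H) l l' z w :
  (forall n, rdot (u n) w = rdot z (u' n)) -> tends u l -> tends u' l' ->
  rdot l w = rdot z l'.
Proof.
move=> uu' ul ul'; apply/eqP; rewrite -subr_eq0 -normr_le0 leNgt.
apply/negP => d0; pose c := nrm w + nrm z + 1.
have c0 : 0 < c by rewrite ltr_wpDl// addr_ge0 ?nrm_ge0.
pose e := `|rdot l w - rdot z l'| / c.
have e0 : 0 < e by rewrite divr_gt0.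
have ec : e * c = `|rdot l w - rdot z l'| by rewrite divfK ?gt_eqF.
have [N uN] := ul _ e0; have [N' uN'] := ul' _ e0; pose n := maxn N N'.
have h := uN n (leq_maxl _ _); have h' := uN' n (leq_maxr _ _).
have : `|rdot l w - rdot z l'| <= e * nrm w + e * nrm z.
  have -> : rdot l w - rdot z l' = rdot z (u' n - l') - rdot (u n - l) w.
    by rewrite rdotBr rdotBl uu'; ring.
  rewrite (le_trans (ler_normB _ _))// addrC.
  apply: lerD; apply: le_trans (rdot_le_norm _ _) _.
    by rewrite ler_wpM2r ?nrm_ge0// ltW.
  by rewrite mulrC ler_wpM2r ?nrm_ge0// ltW.
by rewrite -ec /c; nra.
Qed.

Lemma pointwise_limit (T : nat -> H -> H) (C : R) :
  (forall n, bounded_op (T n)) -> (forall n x, nrm (T n x) <= C * nrm x) ->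
  (forall x (e : R), 0 < e -> exists N, forall m n,
     (N <= m)%N -> (N <= n)%N -> nrm (T m x - T n x) < e) ->
  exists2 S, bounded_op S & forall x, tends (T ^~ x) (S x).
Proof.
move=> bT TC cT; have /choice[S SP] x : exists l, tends (T ^~ x) l.
  by have [l lP] := nrm_complete (cT x); exists l.
exists S => //; apply/bounded_opP; split.
  move=> c x y; apply: (tends_unique (SP _)).
  have := tendsD (tendsZ c (SP x)) (SP y); apply: (@tends_eventually _ _ _ 0).
  by move=> n _; rewrite (bopD (bT n)) (bopZ (bT n)).
by exists C => x; apply: tends_le (SP x).
Qed.

Lemma monotone_cauchy (s : nat -> R) C : (forall n, s n <= s n.+1) ->
  (forall n, s n <= C) -> forall e, 0 < e ->
  exists N, forall m n, (N <= m)%N -> (N <= n)%N -> `|s m - s n| < e.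
Proof.
move=> s1 sC e e0; have smono : {homo s : m n / (m <= n)%N >-> m <= n}.
  by apply: homo_leq => //; exact: le_trans.
have hs : has_sup (range s).
  by split; [exists (s 0), 0|exists C => _ [n _ <-]; exact: sC].
have [_ [N _ <-] sN] := sup_adherent e0 hs; exists N => m n Nm Nn.
have sle k : s k <= sup (range s) by apply: ub_le_sup; [exact: hs.2|exists k].
have := sle m; have := sle n; have := smono _ _ Nm; have := smono _ _ Nn.
by rewrite ltr_norml; lra.
Qed.

Section Algebra.
Variables (D : set (H -> H)) (vD : von_neumann D).

Lemma vn_bop T : D T -> bounded_op T.
Proof. by case: vD => -[+ _ _ _ _] _ _ => /[apply]. Qed.

Lemma vn_add S T : D S -> D T -> D (S \+ T).
Proof. by case: vD => -[_ h _ _ _] _ _; exact: h. Qed.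

Lemma vn_scale (c : R[i]) T : D T -> D (c \*: T).
Proof. by case: vD => -[_ _ h _ _] _ _; exact: h. Qed.

Lemma vn_comp S T : D S -> D T -> D (S \o T).
Proof. by case: vD => -[_ _ _ h _] _ _; exact: h. Qed.

Lemma vn_adj T : D T -> D (adj T).
Proof. by case: vD => -[_ _ _ _ h] _ _; exact: h. Qed.

Lemma vn_id : D id.
Proof. by case: vD. Qed.

Lemma vn_cst0 : D (cst 0).
Proof.
have := vn_scale 0 vn_id; congr D; apply/funext => x; exact: scale0r.
Qed.

Lemma vn_sub S T : D S -> D T -> D (fun x => S x - T x).
Proof.
move=> DS /(vn_scale (-1)) /(vn_add DS); congr D; apply/funext => x.
by rewrite /= scaleN1r.
Qed.

Lemma commutantE S T x : commutant D S -> D T -> T (S x) = S (T x).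
Proof. by move=> [_ +] /[dup] DT => /[apply] /(congr1 (@^~ x)). Qed.

Lemma commutant_bop S : commutant D S -> bounded_op S.
Proof. by case. Qed.

Lemma commutant_adj S : commutant D S -> commutant D (adj S).
Proof.
move=> cS; have bS := commutant_bop cS; split; first exact: bop_adj.
move=> T DT; have bT := vn_bop DT; rewrite -[T](adjK bT).
have bT' := bop_adj bT; rewrite -!adj_comp//; congr adj.
by apply/funext => x /=; rewrite (commutantE _ cS)//; exact: vn_adj.
Qed.

Lemma commutant_scale (c : R[i]) : commutant D (c \*: id).
Proof.
split; first exact/bop_scale/bop_id.
by move=> T /vn_bop bT; apply/funext => x /=; rewrite (bopZ bT).
Qed.

(** The double commutant property as a membership test: pointwise limits,
    projections and the factors of polar decompositions are shown to lie in D
    by it. *)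
Lemma vn_bicommutant T : bounded_op T ->
  (forall S, commutant D S -> forall x, T (S x) = S (T x)) -> D T.
Proof.
move=> bT TS; have [_ _ <-] := vD; split=> // S cS.
by apply/funext => x; exact: TS.
Qed.

Lemma vn_limit (T : nat -> H -> H) S : (forall n, D (T n)) -> bounded_op S ->
  (forall x, tends (T ^~ x) (S x)) -> D S.
Proof.
move=> DT bS TS; apply: vn_bicommutant => // U cU x.
apply: (tends_unique (TS _)); have := tends_bop (commutant_bop cU) (TS x).
by apply: (@tends_eventually _ _ _ 0) => n _; rewrite (commutantE _ cU).
Qed.

End Algebra.

Lemma closed_subspace_ker (I : Type) (T : I -> H -> H) :
  (forall i, bounded_op (T i)) ->
  closed_subspace [set x | forall i, T i x = 0].
Proof.
move=> bT; split=> /= [i|x y Tx Ty i|r x Tx i|x cx i]; first exact: bop0.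
- by rewrite (bopD (bT i)) Tx Ty addr0.
- by rewrite (bopZ (bT i)) Tx scaler0.
- have [C C0 TC] := bop_bound (bT i); apply: small_eq0 => e e0.
  have [|y Ty] := cx (e / C); first by rewrite divr_gt0.
  rewrite ltr_pdivlMr// mulrC; apply: le_lt_trans.
  by rewrite -[T i x](subr0) -(Ty i) -(bopB (bT i)).
Qed.

(** The last clause: a subspace that is invariant under S and its adjoint
    reduces S. *)
Lemma projection_onto L : closed_subspace L ->
  (forall (c : R[i]) x, L x -> L (c *: x)) ->
  exists P, [/\ bounded_op P, forall x, P (P x) = P x, adj P = P,
    forall x, L x <-> P x = x &
    forall S, bounded_op S -> (forall x, L x -> L (S x)) ->
      (forall x, L x -> L (adj S x)) -> forall x, P (S x) = S (P x)].
Proof.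
move=> cL LZ; have [L0 LD LR Lc] := cL.
have /choice[P PP] x : exists k, L k /\ forall y, L y -> rdot (x - k) y = 0.
  by have [k] := exists_projection x cL; exists k.
have LB x y : L x -> L y -> L (x - y).
  by move=> Lx Ly; apply: LD => //; rewrite -scaleN1r; exact: LZ.
have LP x : L (P x) by case: (PP x).
have oP x y : L y -> rdot (x - P x) y = 0 by move=> ?; case: (PP x) => _ ->.
have uP x k : L k -> (forall y, L y -> rdot (x - k) y = 0) -> P x = k.
  move=> Lk ok; apply/eqP; rewrite -subr_eq0; apply/eqP/rdot_eq0.
  have LPk : L (P x - k) by exact: LB.
  rewrite {1}(_ : P x - k = (x - k) - (x - P x)).
    by rewrite rdotBl ok// oP// subrr.
  by rewrite opprB [RHS]addrC addrA subrK.
have LPE x : L x -> P x = x.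
  by move=> Lx; apply: uP => // y _; rewrite subrr rdot0l.
have bP : bounded_op P.
  apply/bounded_opP; split=> [c x y|].
    apply: uP => [|k Lk]; first by apply: LD => //; exact: LZ.
    rewrite opprD addrACA -scalerBr rdotDl rdotZ !oP ?addr0//; exact: LZ.
  exists 1 => x; rewrite mul1r -ler_sqr ?nnegrE ?nrm_ge0//.
  rewrite -[in leRHS](subrK (P x) x) nrmD2 oP// mulr0 addr0 lerDr.
  exact: sqr_ge0.
have oPr x y : rdot (P x) (P y) = rdot (P x) y.
  by apply/esym/eqP; rewrite -subr_eq0 -rdotBr rdotC oP.
exists P; split=> //.
- by move=> x; exact: LPE.
- by apply: adj_eq => // x y; rewrite -oPr rdotC oPr rdotC.
- by move=> x; split=> [/LPE//|<-].
- move=> S bS LS LS' x; apply: uP => [|y Ly]; first exact: LS.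
  by rewrite -(bopB bS) adjP// oP//; exact: LS'.
Qed.

(** The commutant is closed under adjoints, so L reduces each of its
    elements. *)
Lemma vn_projection D L : von_neumann D -> closed_subspace L ->
  (forall S, commutant D S -> forall x, L x -> L (S x)) ->
  exists P, projection D P /\ forall x, L x <-> P x = x.
Proof.
move=> vD cL LS.
have [P [bP PP aP LP cP]] := projection_onto cL
  (fun c => LS _ (commutant_scale vD c)).
exists P; split=> //; split=> //; last exact/funext.
apply: vn_bicommutant => // S cS x; apply: cP.
- exact: commutant_bop cS.
- exact: LS.
- exact/LS/commutant_adj.
Qed.

(** Cancellation of A. For S in the commutant, Y = X S - S X satisfies
    A Y A = 0. So m = Y A z is in the kernel of A, and so is S^* m. The adjoint
    of X kills both, and expanding rdot m m by the definition of Y gives m = 0.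
    Thus Y A = 0, and the same argument for the adjoint of Y gives Y = 0. *)
Lemma vn_sandwich D A X : von_neumann D -> D A -> adj A = A -> bounded_op X ->
  (forall x, A x = 0 -> X x = 0) -> (forall x, A x = 0 -> adj X x = 0) ->
  D (A \o X \o A) -> D X.
Proof.
move=> vD DA aA bX kX kX' DX; apply: vn_bicommutant => // S cS.
have bA := vn_bop vD DA; have bS := commutant_bop cS.
have cS' := commutant_adj vD cS.
have YA z : X (S (A z)) = S (X (A z)).
  apply/eqP; rewrite -subr_eq0; apply/eqP; set m := _ - _.
  have Am : A m = 0.
    have := commutantE z cS DX; rewrite /= => AXA.
    rewrite /m (bopB bA) -(commutantE z cS DA) AXA.
    by rewrite (commutantE _ cS DA) subrr.
  apply: rdot_eq0; rewrite {1}/m rdotBl (adjP _ _ bX) (kX' _ Am) rdot0r sub0r.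
  rewrite (adjP _ _ bS) (adjP _ _ bX) kX' ?rdot0r ?oppr0//.
  by rewrite (commutantE _ cS' DA) Am (bop0 (bop_adj bS)).
move=> x; apply: rdot_inj => w.
pose m := adj S (adj X w) - adj X (adj S w).
have bX' := bop_adj bX; have bS' := bop_adj bS.
have Am : A m = 0.
  apply: rdot_inj => z; rewrite rdot0l (adjP _ _ bA) aA rdotC /m rdotBr.
  by rewrite -(adjP _ _ bS) -!(adjP _ _ bX) -(adjP _ _ bS) YA subrr.
have m0 : m = 0.
  apply: rdot_eq0; rewrite {2}/m rdotBr -(adjP _ _ bS) -!(adjP _ _ bX).
  rewrite -(adjP _ _ bS) (kX _ Am) (bop0 bS) rdot0l subr0 kX ?rdot0l//.
  by rewrite (commutantE _ cS DA) Am (bop0 bS).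
apply/eqP; rewrite -subr_eq0 (adjP _ _ bX) !(adjP _ _ bS) (adjP _ _ bX).
by rewrite -rdotBr -/m m0 rdot0r.
Qed.

End VonNeumann.

(** * Square roots and polar decomposition *)

Section Polar.
Context {R : realType} {H : hilbertType R}.
Implicit Types (x : H -> H) (T S P h v : H -> H) (z w : H) (D : set (H -> H)).

(** The iteration y |-> (x + y^2) / 2, whose fixed points satisfy
    (1 - y)^2 = 1 - x. *)
Fixpoint sqrt_iter x n z : H :=
  if n is k.+1 then (2^-1)%:C *: (x z + sqrt_iter x k (sqrt_iter x k z)) else 0.

(** The same iteration for the number x = 1. It increases, is bounded by 1, and
    its increments dominate those of the operator iteration. *)
Fixpoint sqrt_iter_bound n : R :=
  if n is k.+1 then 2^-1 * (1 + sqrt_iter_bound k ^+ 2) else 0.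

(** The iteration converges in norm: from Y^2 - Z^2 = Y (Y - Z) + (Y - Z) Z one
    gets by induction that the increments of [sqrt_iter] are bounded by those of
    [sqrt_iter_bound], whose sum is finite. *)
Lemma contraction_sqrt x : bounded_op x -> adj x = x ->
  (forall z, nrm (x z) <= nrm z) ->
  exists y, [/\ bounded_op y, adj y = y,
    forall z, y z + y z = x z + y (y z) &
    forall S, bounded_op S -> (forall z, x (S z) = S (x z)) ->
      forall z, y (S z) = S (y z)].
Proof.
move=> bx ax x1; pose Y := sqrt_iter x; pose s := sqrt_iter_bound.
have YSn n z : Y n.+1 z = (2^-1)%:C *: (x z + Y n (Y n z)) by [].
have half : 2^-1 + 2^-1 = 1 :> R by field.
have half0 : 0 <= 2^-1 :> R by rewrite invr_ge0.
have bY n : bounded_op (Y n).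
  elim: n => [|n bYn]; first exact: bop_cst0.
  exact: (bop_scale (2^-1)%:C (bop_add bx (bop_comp bYn bYn))).
have s01 n : 0 <= s n <= 1 by elim: n => [|n /andP[]] /=; rewrite -/s; nra.
have s1 n : s n <= s n.+1 by rewrite /= -/s; have := s01 n => /andP[]; nra.
have Ys n z : nrm (Y n z) <= s n * nrm z.
  elim: n z => [|n IH] z; first by rewrite /= nrm0 mul0r.
  rewrite /= -/Y -/s nrmRpos// -mulrA ler_wpM2l// mulrDl mul1r.
  rewrite (le_trans (nrmD _ _))// lerD// expr2 -mulrA (le_trans (IH _))//.
  by rewrite ler_wpM2l//; case/andP: (s01 n).
have YS n z : nrm (Y n.+1 z - Y n z) <= (s n.+1 - s n) * nrm z.
  elim: n z => [|n IH] z.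
    by have := Ys 1 z; rewrite /= !subr0.
  rewrite [Y n.+2]/= [Y n.+1 in X in _ - X]/= -/Y -scalerBr nrmRpos//.
  have -> : s n.+2 - s n.+1 = 2^-1 * ((s n.+1 - s n) * (s n.+1 + s n)).
    by rewrite /= -/s; ring.
  rewrite -mulrA ler_wpM2l// opprD addrACA subrr add0r.
  have -> : Y n.+1 (Y n.+1 z) - Y n (Y n z) =
      (Y n.+1 (Y n.+1 z) - Y n (Y n.+1 z)) + Y n (Y n.+1 z - Y n z).
    by rewrite (bopB (bY n)) addrA subrK.
  have z0 := nrm_ge0 z; have := s1 n; have /andP[sn0 _] := s01 n.
  have := nrmD (Y n.+1 (Y n.+1 z) - Y n (Y n.+1 z)) (Y n (Y n.+1 z - Y n z)).
  have := IH (Y n.+1 z); have := Ys n.+1 z.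
  have := Ys n (Y n.+1 z - Y n z); have := IH z.
  move: (nrm (Y n (Y n.+1 z - Y n z))) (nrm (Y n.+1 z - Y n z)).
  move: (nrm (Y n.+1 (Y n.+1 z) - Y n (Y n.+1 z))) (nrm (Y n.+1 z)).
  move: (nrm (_ + _)) (nrm z) (s n.+1) z0 (s n) sn0 => t d s' d0 sn sn0 a b c f.
  move=> fd cf bs ab tab ss; apply: (le_trans tab).
  have : (s' - sn) * b <= (s' - sn) * (s' * d) by rewrite ler_wpM2l ?subr_ge0.
  have : sn * f <= sn * ((s' - sn) * d) by rewrite ler_wpM2l.
  by move: ab cf; rewrite -/Y; lra.
have Yk k n z : nrm (Y (k + n)%N z - Y n z) <= (s (k + n)%N - s n) * nrm z.
  elim: k => [|k IH]; first by rewrite add0n !subrr nrm0 mul0r.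
  rewrite addSn -(subrK (Y (k + n)%N z) (Y (k + n).+1 z)) -addrA.
  rewrite (le_trans (nrmD _ _))// -(subrK (s (k + n)%N) (s (k + n).+1)).
  by rewrite -addrA mulrDl lerD.
have smono : {homo s : m n / (m <= n)%N >-> m <= n}.
  by apply: homo_leq => //; exact: le_trans.
have cY z (e : R) : 0 < e -> exists N, forall m n,
    (N <= m)%N -> (N <= n)%N -> nrm (Y m z - Y n z) < e.
  move=> e0; have z0 : 0 < nrm z + 1 by rewrite ltr_wpDl ?nrm_ge0.
  have [|||N sN] := @monotone_cauchy _ s 1 _ _ (e / (nrm z + 1)).
  - exact: s1.
  - by move=> n; case/andP: (s01 n).
  - by rewrite divr_gt0.
  exists N => m n Nm Nn; wlog nm : m n Nm Nn / (n <= m)%N.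
    by case/orP: (leq_total n m) => mn h; [|rewrite nrmBC]; exact: h.
  rewrite -(subnK nm) (le_lt_trans (Yk _ _ _))// subnK//.
  have := sN _ _ Nm Nn; rewrite ltr_pdivlMr// => h; apply: le_lt_trans h.
  rewrite ler_pM ?nrm_ge0 ?ler_norm ?lerDl// subr_ge0.
  exact: smono.
have Y1 n z : nrm (Y n z) <= 1 * nrm z.
  by rewrite (le_trans (Ys n z))// ler_wpM2r ?nrm_ge0//; case/andP: (s01 n).
have [y by_ yP] := pointwise_limit bY Y1 cY.
exists y; split=> //.
- apply: adj_eq => // z w; apply: tends_rdot_eq (yP z) (yP w) => n /=.
  elim: n z w => [|n IH] z w /=; first by rewrite rdot0l rdot0r.
  by rewrite rdotRl rdotRr rdotDl rdotDr !IH (adjP _ _ bx) ax.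
- move=> z; have yS : tends (fun n => Y n.+1 z) (y z).
    by move=> e /(yP z)[N YN]; exists N => n Nn; apply: YN; exact: leqW.
  have yy : tends (fun n => Y n (Y n z)) (y (y z)).
    have t1 : tends (fun n => Y n (Y n z - y z)) 0.
      apply: tends_dominated (yP z) => n; rewrite subr0; exact: Y1.
    have := tendsD t1 (yP (y z)); rewrite add0r.
    apply: (@tends_eventually _ _ _ _ _ 0) => n _.
    by rewrite (bopB (bY n)) subrK.
  have xyy : tends (fun n => Y n.+1 z + Y n.+1 z) (x z + y (y z)).
    have := tendsD (@tends_const _ _ (x z)) yy.
    apply: (@tends_eventually _ _ _ _ _ 0) => n _ /=.
    by rewrite -scalerDl -rmorphD /= half scale1r.
  exact: tends_unique (tendsD yS yS) xyy.
- move=> S bS xS z; apply: tends_unique (yP _) _.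
  have := tends_bop bS (yP z); apply: (@tends_eventually _ _ _ _ _ 0) => n _.
  elim: n z => [|n IH] z /=; first exact: bop0.
  by rewrite !YSn (bopZ bS) (bopD bS) xS !IH.
Qed.

(** If C bounds x and its adjoint and c = C^-2, then 1 - c x^* x is a
    contraction and [contraction_sqrt] gives a square root of c x^* x. *)
Lemma operator_abs x : bounded_op x ->
  exists h, [/\ bounded_op h, adj h = h, forall z, h (h z) = adj x (x z) &
    forall S, bounded_op S ->
      (forall z, adj x (x (S z)) = S (adj x (x z))) ->
      forall z, h (S z) = S (h z)].
Proof.
move=> bx; have bx' := bop_adj bx.
have [C1 C10 xC1] := bop_bound bx; have [C2 C20 xC2] := bop_bound bx'.
pose C := C1 + C2; pose c := (C ^+ 2)^-1.
have C0 : 0 < C by rewrite addr_gt0.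
have c0 : 0 < c by rewrite invr_gt0 exprn_gt0.
have cC : c * C ^+ 2 = 1 by rewrite mulVf// gt_eqF// exprn_gt0.
pose a := fun z => z - c%:C *: adj x (x z).
have aE : a = id \+ ((- c)%:C \*: (adj x \o x)).
  by apply/funext => z; rewrite /a /= rmorphN scaleNr.
have bcx : bounded_op ((- c)%:C \*: (adj x \o x)).
  exact/bop_scale/bop_comp.
have ba : bounded_op a by rewrite aE; exact: bop_add (@bop_id _ _) bcx.
have aa : adj a = a.
  apply: adj_eq => // z w; rewrite rdotBl rdotBr rdotRl rdotRr.
  by rewrite (adjP _ _ bx') adjK// -(adjP _ _ bx).
have a1 z : nrm (a z) <= nrm z.
  rewrite -ler_sqr ?nnegrE ?nrm_ge0// nrmB2 nrmR rdotRr (adjPr _ _ bx').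
  rewrite adjK// rdotxx; have := xC2 (x z); have := nrm_ge0 (x z).
  have := nrm_ge0 (adj x (x z)).
  move: (nrm (adj x (x z))) (nrm (x z)) (nrm z) => A B d A0 B0 AB.
  have A2 : A ^+ 2 <= C ^+ 2 * B ^+ 2.
    have CB : 0 <= C * B by rewrite mulr_ge0// ltW.
    rewrite -exprMn ler_sqr ?nnegrE//.
    by rewrite (le_trans AB)// ler_wpM2r// lerDr ltW.
  have : c ^+ 2 * A ^+ 2 <= c ^+ 2 * (C ^+ 2 * B ^+ 2).
    by rewrite ler_wpM2l// sqr_ge0.
  have -> : c ^+ 2 * (C ^+ 2 * B ^+ 2) = c * B ^+ 2.
    by rewrite mulrA [c ^+ 2]expr2 -[c * c * _]mulrA cC mulr1.
  have : 0 <= c * B ^+ 2 by rewrite mulr_ge0 ?sqr_ge0// ltW.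
  by lra.
have [y [by_ ay yE cy]] := contraction_sqrt ba aa a1.
pose h := C%:C \*: (id \+ (-1) \*: y).
have hE z : h z = C%:C *: (z - y z) by rewrite /h /= scaleN1r.
have bh : bounded_op h.
  exact: bop_scale (bop_add (@bop_id _ _) (bop_scale _ by_)).
exists h; split=> //.
- apply: adj_eq => // z w; rewrite !hE rdotRl rdotRr rdotBl rdotBr.
  by rewrite (adjP _ _ by_) ay.
- move=> z; rewrite !hE (bopZ by_) (bopB by_) -scalerBr scalerA -rmorphM.
  have -> : z - y z - (y z - y (y z)) = c%:C *: adj x (x z).
    rewrite opprB addrACA -opprD yE opprD addrACA subrr addr0.
    by rewrite /a subKr.
  by rewrite scalerA -rmorphM -expr2 mulrC cC scale1r.
- move=> S bS xS z; rewrite !hE (bopZ bS) (bopB bS) cy// => w.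
  by rewrite /a (bopB bS) (bopZ bS) xS.
Qed.

(** Here h is any self-adjoint operator with h^2 = x^* x, positive or not: then
    h z and x z have equal norms, and this is what makes v a partial
    isometry. *)
Record polar_decomposition x v h : Prop := PolarDecomposition {
  polar_bop : bounded_op v;
  polar_abs_bop : bounded_op h;
  polar_abs_sa : adj h = h;
  polar_abs2 : forall z, h (h z) = adj x (x z);
  polarE : forall z, v (h z) = x z;
  polar_adjE : forall z, adj v (x z) = h z;
  polar_pi : forall z, v (adj v (v z)) = v z;
  polar_ker : forall z, h z = 0 -> v z = 0;
  polar_adj_ker : forall z, adj x z = 0 -> adj v z = 0;
  polar_abs_vn : forall D, von_neumann D -> D (adj x \o x) -> D h;
  polar_vn : forall D, von_neumann D -> D x -> D v }.

(** As h z and x z have equal norms, h z |-> x z is a well defined isometry on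
    the range of h. It extends to the closure K of the range by continuity, and
    v is this extension after the projection P onto K: v z is the limit of the
    x (u n) for any sequence u such that h (u n) tends to P z. *)
Lemma polar x : bounded_op x -> exists v h, polar_decomposition x v h.
Proof.
move=> bx; have bx' := bop_adj bx.
have [h [bh ah hE ch]] := operator_abs bx.
have nh z : nrm (h z) = nrm (x z).
  apply/eqP; rewrite -(eqrXn2 (n := 2))// ?nrm_ge0// -!rdotxx.
  by rewrite (adjP _ _ bh) ah hE (adjPr _ _ bx') adjK.
have chn D : von_neumann D -> D (adj x \o x) -> D h.
  move=> vD Dxx; apply: (vn_bicommutant vD bh) => S cS.
  apply: ch; first exact: commutant_bop cS.
  by move=> z; have := commutantE z cS Dxx.
pose K := [set z | forall e : R, 0 < e -> exists w, nrm (z - h w) < e].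
have K0 w : K (h w) by move=> e e0; exists w; rewrite subrr nrm0.
have KD z z' : K z -> K z' -> K (z + z').
  move=> Kz Kz' e e0; have e2 : 0 < e / 2 by rewrite divr_gt0.
  have [w zw] := Kz _ e2; have [w' zw'] := Kz' _ e2; exists (w + w').
  rewrite (bopD bh) opprD addrACA (splitr e).
  by apply: (le_lt_trans (nrmD _ _)); exact: ltrD.
have KS S : bounded_op S -> (forall z, h (S z) = S (h z)) ->
    forall z, K z -> K (S z).
  move=> bS hS z Kz e e0; have [C C0 SC] := bop_bound bS.
  have [|w zw] := Kz (e / C); first by rewrite divr_gt0.
  exists (S w); rewrite hS -(bopB bS) (le_lt_trans (SC _))//.
  by rewrite mulrC -ltr_pdivlMr.
have KZ (c : R[i]) z : K z -> K (c *: z).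
  apply: (KS (c \*: id)) => [|w]; first exact/bop_scale/bop_id.
  by rewrite /= (bopZ bh).
have cK : closed_subspace K.
  split=> //; first by have := K0 0; rewrite (bop0 bh).
    by move=> r z; exact: KZ.
  move=> z zK e e0; have e2 : 0 < e / 2 by rewrite divr_gt0.
  have [y Ky zy] := zK _ e2; have [w yw] := Ky _ e2; exists w.
  rewrite -(subrK y z) -addrA (splitr e).
  by apply: (le_lt_trans (nrmD _ _)); exact: ltrD.
have [P [bP PP aP KP cP]] := projection_onto cK KZ.
have KPz z : K (P z) by apply/KP.
have /choice[u uP] z : exists u : nat -> H, tends (fun n => h (u n)) (P z).
  have /choice[u uP] (n : nat) : exists w, nrm (P z - h w) < n.+1%:R^-1.
    by apply: KPz; rewrite invr_gt0.
  exists u => e /inv_small[N NP]; exists N => n /NP; rewrite nrmBC.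
  exact: lt_trans.
(* x w and h w have equal norms, so convergence passes from h to x. *)
have hx (t : nat -> H) :
    tends (fun n => h (t n)) 0 -> tends (fun n => x (t n)) 0.
  apply: (@tends_dominated _ _ _ _ _ _ 1) => n.
  by rewrite !subr0 mul1r nh.
have /choice[v vP] z : exists l, tends (fun n => x (u z n)) l.
  have [|l lP] := @nrm_complete _ _ (fun n => x (u z n)); last by exists l.
  move=> e e0; have e2 : 0 < e / 2 by rewrite divr_gt0.
  have [N uN] := uP z _ e2; exists N => m n /uN um /uN un.
  rewrite -(bopB bx) -nh (bopB bh) -(subrK (P z) (h (u z m))) -addrA (splitr e).
  by apply: (le_lt_trans (nrmD _ _)); apply: ltrD => //; rewrite nrmBC.
(* Any sequence with the same limit under h gives the same v z; this yields the
   linearity of v and its commutation properties. *)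
have vU z (t : nat -> H) : tends (fun n => h (t n)) (P z) ->
    tends (fun n => x (t n)) (v z).
  move=> tz; have := tendsB tz (uP z); rewrite subrr => d.
  have := tendsD (hx (fun n => t n - u z n) _) (vP z); rewrite add0r => d'.
  apply: (tends_eventually (N := 0)) (d' _) => [n _|].
    by rewrite (bopB bx) subrK.
  by apply: (tends_eventually (N := 0)) d => n _; rewrite (bopB bh).
have vE z l (t : nat -> H) : tends (fun n => h (t n)) (P z) ->
    tends (fun n => x (t n)) l -> v z = l.
  by move=> /vU; exact: tends_unique.
have nv z : nrm (v z) = nrm (P z).
  apply/eqP; rewrite eq_le.
  by apply/andP; split; [apply: tends_nrm_le (vP z) (uP z)|
    apply: tends_nrm_le (uP z) (vP z)] => n; rewrite nh.
have bv : bounded_op v.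
  apply/bounded_opP; split=> [c z z'|]; last first.
    by have [C _ PC] := bop_bound bP; exists C => z; rewrite nv.
  apply: (vE _ _ (fun n => c *: u z n + u z' n)).
    rewrite (bopD bP) (bopZ bP); have := tendsD (tendsZ c (uP z)) (uP z').
    by apply: (tends_eventually (N := 0)) => n _; rewrite (bopD bh) (bopZ bh).
  have := tendsD (tendsZ c (vP z)) (vP z').
  by apply: (tends_eventually (N := 0)) => n _; rewrite (bopD bx) (bopZ bx).
have Phz z : P (h z) = h z by apply/KP.
have vh z : v (h z) = x z.
  by apply: (vE _ _ (fun=> z)); rewrite ?Phz; exact: tends_const.
have vv z z' : rdot (v z) (v z') = rdot (P z) (P z').
  have := nrmD2 (v z) (v z'); rewrite -(bopD bv) !nv (bopD bP) nrmD2.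
  lra.
have kerP z : h z = 0 -> P z = 0.
  move=> hz; apply: rdot_eq0; rewrite (adjP _ _ bP) aP PP rdotC.
  rewrite -(rdot0l (0 : H)).
  apply: tends_rdot_eq (uP z) (tends_const 0) => n.
  by rewrite (adjP _ _ bh) ah hz !rdot0r.
have v'v z : adj v (v z) = P z.
  apply: rdot_inj => w; rewrite (adjP _ _ (bop_adj bv)) adjK// vv.
  by rewrite (adjPr _ _ bP) aP PP.
exists v, h; split=> //.
- by move=> z; rewrite -vh v'v Phz.
- move=> z; rewrite v'v; apply/eqP; rewrite -subr_eq0 -(bopB bv); apply/eqP.
  by apply: nrm_eq0; rewrite nv (bopB bP) PP subrr nrm0.
- by move=> z /kerP Pz; apply: nrm_eq0; rewrite nv Pz nrm0.
- move=> z xz; apply: rdot_inj => w.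
  rewrite rdot0l (adjP _ _ (bop_adj bv)) adjK//.
  rewrite rdotC -(rdot0l (0 : H)).
  apply: tends_rdot_eq (vP w) (tends_const 0) => n.
  by rewrite (adjP _ _ bx) xz !rdot0r.
- move=> D vD Dx; have Dh := chn D vD (vn_comp vD (vn_adj vD Dx) Dx).
  apply: (vn_bicommutant vD bv) => S cS z.
  have bS := commutant_bop cS.
  apply: (vE _ _ (fun n => S (u z n))).
    rewrite cP//.
    + have := tends_bop bS (uP z); apply: (tends_eventually (N := 0)) => n _.
      by rewrite (commutantE _ cS Dh).
    + apply: (KS _ bS) => w; exact: commutantE cS Dh.
    + apply: KS => [|w]; first exact: bop_adj.
      exact: commutantE (commutant_adj vD cS) Dh.
  have := tends_bop bS (vP z); apply: (tends_eventually (N := 0)) => n _.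
  by rewrite (commutantE _ cS Dx).
Qed.

End Polar.

(** * Infinite sums of orthogonal partial isometries *)

Section Sums.
Context {R : realType} {H : hilbertType R}.
Implicit Types (T S : H -> H) (z w : H) (D : set (H -> H)) (a : nat -> H -> H).

(** Partial isometries with pairwise orthogonal ranges and pairwise orthogonal
    initial spaces. Their sum converges strongly to a partial isometry, and so
    does the sum of their adjoints. *)
Record orth_pis a : Prop := OrthPis {
  opi_bop : forall k, bounded_op (a k);
  opi_pi : forall k z, a k (adj (a k) (a k z)) = a k z;
  opi_ran : forall j k z, j != k -> adj (a j) (a k z) = 0;
  opi_dom : forall j k z, j != k -> a j (adj (a k) z) = 0 }.

Lemma pi_adj T : bounded_op T -> (forall z, T (adj T (T z)) = T z) ->
  forall z, adj T (T (adj T z)) = adj T z.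
Proof.
move=> bT TT z; have bT' := bop_adj bT; apply: rdot_inj => w.
rewrite (adjP _ _ bT') adjK// (adjP _ _ bT) (adjP _ _ bT') adjK//.
by rewrite TT (adjP _ _ bT') adjK.
Qed.

Lemma orth_pis_adj a : orth_pis a -> orth_pis (fun k => adj (a k)).
Proof.
move=> [ba api aran adom]; split=> [k|k z|j k z jk|j k z jk].
- exact: bop_adj.
- by rewrite adjK//; exact: pi_adj.
- by rewrite adjK// adom.
- by rewrite adjK// aran.
Qed.

Definition psum a n z : H := \sum_(k < n) a k z.

Lemma psumS a n z : psum a n.+1 z = psum a n z + a n z.
Proof. exact: big_ord_recr. Qed.

Lemma bop_psum a n : (forall k, bounded_op (a k)) -> bounded_op (psum a n).
Proof.
move=> ba; elim: n => [|n IH].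
  have := @bop_cst0 R H; congr bounded_op.
  by apply/funext => z; rewrite /psum big_ord0.
have := bop_add IH (ba n); congr bounded_op.
by apply/funext => z; rewrite psumS.
Qed.

Lemma vn_psum D a n : von_neumann D -> (forall k, D (a k)) -> D (psum a n).
Proof.
move=> vD Da; elim: n => [|n IH].
  by have := vn_cst0 vD; congr D; apply/funext => z; rewrite /psum big_ord0.
by have := vn_add vD IH (Da n); congr D; apply/funext => z; rewrite psumS.
Qed.

Lemma psum_bop T a n z : bounded_op T ->
  T (psum a n z) = psum (fun k => T \o a k) n z.
Proof.
move=> bT; elim: n => [|n IH]; first by rewrite /psum !big_ord0 (bop0 bT).
by rewrite !psumS (bopD bT) IH.
Qed.

Lemma psum_single a k n z : (forall j, j != k -> a j z = 0) -> (k < n)%N ->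
  psum a n z = a k z.
Proof.
move=> az kn; rewrite /psum (bigD1 (Ordinal kn))//= big1 ?addr0// => i ik.
by apply: az; apply: contra ik => /eqP ik; apply/eqP/val_inj.
Qed.

Definition sot_sum a S :=
  bounded_op S /\ forall z, tends (fun n => psum a n z) (S z).

Lemma tail_pythagoras a : orth_pis a -> forall m n z,
  nrm (psum a (n + m) z - psum a m z) ^+ 2 =
  \sum_(k < n) nrm (a (k + m)%N z) ^+ 2.
Proof.
move=> [ba api aran adom] m n z; elim: n => [|n IH].
  by rewrite add0n subrr nrm0 expr0n /= big_ord0.
rewrite addSn psumS addrAC nrmD2 IH big_ord_recr /= rdotBl.
suff h k : (k <= n + m)%N -> rdot (psum a k z) (a (n + m)%N z) = 0.
  by rewrite !h ?leq_addl// subrr mulr0 addr0.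
elim: k => [_|k IHk kn]; first by rewrite /psum big_ord0 rdot0l.
rewrite psumS rdotDl IHk ?(ltnW kn)// add0r (adjP _ _ (ba _)) aran ?rdot0r//.
by rewrite ltn_eqF.
Qed.

(** With r_k = a_k^* a_k, the sum c on the left equals both the inner product of
    z with the sum of the r_k z and the square of the norm of that sum, so c is
    at most the norm of z times the square root of c. *)
Lemma bessel a : orth_pis a -> forall n z,
  \sum_(k < n) nrm (a k z) ^+ 2 <= nrm z ^+ 2.
Proof.
move=> oa n z; have [ba api aran adom] := oa.
pose r k := adj (a k) \o a k.
have br k : bounded_op (r k) by exact/bop_comp/ba/bop_adj.
have ar k : adj (r k) = r k by rewrite /r adj_comp ?adjK//; exact: bop_adj.
have rr k w : r k (r k w) = r k w by rewrite /r /= api.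
have or : orth_pis r.
  split=> // [k w|j k w jk|j k w jk]; rewrite ar ?rr//.
    by rewrite /r /= adom// (bop0 (bop_adj (ba j))).
  by rewrite /r /= adom// (bop0 (bop_adj (ba j))).
have nr k : nrm (r k z) ^+ 2 = nrm (a k z) ^+ 2.
  by rewrite -!rdotxx {1}/r /= (adjP _ _ (bop_adj (ba k))) adjK// api.
pose c := \sum_(k < n) nrm (a k z) ^+ 2.
have cE : nrm (psum r n z) ^+ 2 = c.
  have := tail_pythagoras or 0 n z; rewrite addn0 {2}/psum big_ord0 subr0 => ->.
  by apply: eq_bigr => k _; rewrite addn0 nr.
have cD m : rdot z (psum r m z) = \sum_(k < m) nrm (a k z) ^+ 2.
  elim: m => [|m IH]; first by rewrite /psum !big_ord0 rdot0r.
  rewrite psumS rdotDr IH big_ord_recr /=; congr (_ + _).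
  by rewrite -rdotxx (adjP _ _ (ba m)).
have := rdot_le z (psum r n z); rewrite cD -/c => h.
have z0 := nrm_ge0 z; have p0 := nrm_ge0 (psum r n z).
move: cE h z0 p0; move: (nrm (psum r n z)) (nrm z) c => p d c <- h d0 p0.
have [->|p1] := eqVneq p 0; first by rewrite expr0n /= sqr_ge0.
have p2 : 0 < p by rewrite lt_neqAle eq_sym p1.
have : p <= d by rewrite -(ler_pM2r p2) -expr2.
by move=> pd; rewrite ler_sqr ?nnegrE.
Qed.

Lemma sot_sum_exists1 a : orth_pis a -> exists S, sot_sum a S.
Proof.
move=> oa; have [ba api aran adom] := oa.
have [|||S bS SP] := @pointwise_limit _ _ (psum a) 1.
- by move=> n; exact: bop_psum.
- move=> n z; rewrite mul1r -ler_sqr ?nnegrE ?nrm_ge0//.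
  have := tail_pythagoras oa 0 n z; rewrite addn0 {2}/psum big_ord0 subr0 => ->.
  have := bessel oa n z.
  by under [in X in X -> _]eq_bigr do rewrite -[nat_of_ord _]addn0.
- move=> z e e0; pose s n := \sum_(k < n) nrm (a k z) ^+ 2.
  have sS n : s n.+1 = s n + nrm (a n z) ^+ 2 by exact: big_ord_recr.
  have [|||N sN] := @monotone_cauchy _ s (nrm z ^+ 2) _ _ (e ^+ 2).
  + by move=> n; rewrite sS lerDl sqr_ge0.
  + by move=> n; exact: bessel.
  + by rewrite exprn_gt0.
  exists N => m n Nm Nn; wlog nm : m n Nm Nn / (n <= m)%N.
    by case/orP: (leq_total n m) => mn h; [|rewrite nrmBC]; exact: h.
  rewrite -ltr_sqr ?nnegrE ?nrm_ge0 ?ltW// (le_lt_trans _ (sN _ _ Nm Nn))//.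
  rewrite (le_trans _ (ler_norm _))// -(subnK nm) tail_pythagoras//.
  elim: (m - n)%N => [|k IH]; first by rewrite big_ord0 add0n subrr.
  by rewrite big_ord_recr /= addSn sS addrAC lerD.
by exists S.
Qed.

(** Taking adjoints is not continuous for pointwise convergence; the sum of the
    adjoints converges because [orth_pis] is invariant under adjoints. *)
Lemma sot_sum_exists a : orth_pis a ->
  exists S, sot_sum a S /\ sot_sum (fun k => adj (a k)) (adj S).
Proof.
move=> oa; have [S [bS SP]] := sot_sum_exists1 oa; exists S; split=> //.
have [S' [bS' SP']] := sot_sum_exists1 (orth_pis_adj oa).
rewrite (_ : adj S = S')//; apply: adj_eq => // z w.
apply: tends_rdot_eq (SP z) (SP' w) => n.
elim: n => [|n IH]; first by rewrite /psum !big_ord0 rdot0l rdot0r.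
by rewrite !psumS rdotDl rdotDr IH (adjP _ _ (opi_bop oa n)).
Qed.

Section SumTheory.
Variables (a : nat -> H -> H) (S : H -> H).
Hypotheses (oa : orth_pis a) (aS : sot_sum a S).

Lemma sot_sum_adj_mem k z : S (adj (a k) z) = a k (adj (a k) z).
Proof.
case: aS => bS /(_ (adj (a k) z)) SP; apply: tends_unique SP _.
apply: (tends_eventually (N := k.+1)) (tends_const _) => n kn.
by apply/esym/psum_single => // j jk; exact: opi_dom.
Qed.

Lemma sot_sum_ker z : (forall k, a k z = 0) -> S z = 0.
Proof.
move=> az; case: aS => _ /(_ z) SP; apply: tends_unique SP _.
apply: (tends_eventually (N := 0)) (tends_const _) => n _.
by rewrite /psum big1.
Qed.

Lemma bop_sum_eq T T' z : bounded_op T -> bounded_op T' ->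
  (forall k, T (a k z) = T' (a k z)) -> T (S z) = T' (S z).
Proof.
move=> bT bT' TT'; case: aS => _ /(_ z) SP.
apply: tends_unique (tends_bop bT SP) _.
apply: (tends_eventually (N := 0)) (tends_bop bT' SP) => n _.
rewrite !psum_bop//; apply: eq_bigr => k _ /=; exact/esym/TT'.
Qed.

(** The composites may be in D although the a_k are not. *)
Lemma vn_sum_comp D T : von_neumann D -> bounded_op T ->
  (forall k, D (a k \o T)) -> D (S \o T).
Proof.
move=> vD bT DaT; case: aS => bS SP.
apply: (vn_limit vD (T := fun n => psum a n \o T)).
- move=> n; have := vn_psum n vD DaT; congr D; exact/funext.
- exact: bop_comp.
- by move=> z; exact: SP.
Qed.

Lemma vn_sum D : von_neumann D -> (forall k, D (a k)) -> D S.
Proof. by move=> vD Da; apply: (vn_sum_comp vD (@bop_id _ _)). Qed.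

End SumTheory.

Lemma sot_sum_mem a S : orth_pis a -> sot_sum a S ->
  sot_sum (fun k => adj (a k)) (adj S) ->
  forall k z, adj S (a k z) = adj (a k) (a k z).
Proof.
move=> oa aS aS' k z; have := sot_sum_adj_mem (orth_pis_adj oa) aS' k z.
by rewrite adjK//; exact: opi_bop.
Qed.

Lemma sot_sum_pi a S : orth_pis a -> sot_sum a S ->
  sot_sum (fun k => adj (a k)) (adj S) ->
  forall z, S (adj S (S z)) = S z.
Proof.
move=> oa aS aS' z; have bS := aS.1; have oa' := orth_pis_adj oa.
apply: (bop_sum_eq aS (T := S \o adj S) (T' := id)).
- exact/bop_comp/bop_adj.
- exact: bop_id.
- move=> k; rewrite /= (sot_sum_mem oa aS aS') (sot_sum_adj_mem oa aS).
  by rewrite opi_pi.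
Qed.

(** S^* S - 1 vanishes on the initial space of each a_k, and by assumption only
    0 is orthogonal to all of them. *)
Lemma sot_sum_isometry a S : orth_pis a -> sot_sum a S ->
  sot_sum (fun k => adj (a k)) (adj S) ->
  (forall z, (forall k, a k z = 0) -> z = 0) ->
  forall z, adj S (S z) = z.
Proof.
move=> oa aS aS' tot z; have bS := aS.1; have oa' := orth_pis_adj oa.
apply/eqP; rewrite -subr_eq0; apply/eqP/tot => k; have bk := opi_bop oa k.
apply: rdot_inj => w; rewrite rdot0l (adjP _ _ bk) rdotBl.
rewrite (adjP _ _ (bop_adj bS)) adjK// (sot_sum_adj_mem oa aS).
rewrite (adjP _ _ bS) (sot_sum_mem oa aS aS') pi_adj ?subrr//.
exact: opi_pi oa k.
Qed.

(** Apply [vn_sum_comp] to the left factor; taking adjoints exchanges the two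
    factors and it applies again. *)
Lemma vn_sum_conj D a S : von_neumann D -> orth_pis a -> sot_sum a S ->
  (forall j k b, D b -> D (a j \o b \o adj (a k))) ->
  forall b, D b -> D (S \o b \o adj S).
Proof.
move=> vD oa aS Da b Db; have bS := aS.1; have bS' := bop_adj bS.
have bb := vn_bop vD Db; have bb' := bop_adj bb.
apply: (vn_sum_comp aS vD (T := b \o adj S)); first exact: bop_comp.
move=> k; have bk := opi_bop oa k; have bk' := bop_adj bk.
have -> : a k \o (b \o adj S) = adj (S \o (adj b \o adj (a k))).
  rewrite (adj_comp bS (bop_comp bb' bk')) (adj_comp bb' bk').
  by rewrite (adjK bb) (adjK bk).
apply: (vn_adj vD).
apply: (vn_sum_comp aS vD (bop_comp bb' bk')) => j.
by apply: Da; exact: vn_adj.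
Qed.

End Sums.

(** * Partial isometries and isometries in a sigma-finite factor *)

Section Factor.
Context {R : realType} {H : hilbertType R}.
Implicit Types (p e E T S s : H -> H) (z w : H) (B : set (H -> H)).

Lemma projectionE B p : projection B p -> forall z, p (p z) = p z.
Proof. by case=> _ pp _ z; rewrite -[in RHS]pp. Qed.

Lemma neq_cst0 T : T <> cst 0 -> exists z, T z <> 0.
Proof.
move=> T0; apply: contrapT => nz; apply: T0; apply/funext => z.
by apply: contrapT => Tz; apply: nz; exists z.
Qed.

(** The vectors z with E b z = 0 for all b in B form a closed subspace that is
    invariant under B and its commutant. Its projection Q is central, hence a
    scalar. If E b p = 0 for all b, the range of p is in the subspace, so
    Q = 1 and E = 0. *)
Lemma factor_corner B E p : vN_factor B -> projection B E -> projection B p ->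
  E <> cst 0 -> p <> cst 0 -> exists2 b, B b & E \o b \o p <> cst 0.
Proof.
move=> [vB ZB _] pE pp E0 p0; have [BE _ _] := pE; have [Bp _ _] := pp.
apply: contrapT => nb; apply: E0.
have Ebp b z : B b -> E (b (p z)) = 0.
  move=> Bb; have : E \o b \o p = cst 0.
    by apply: contrapT => Ebp; apply: nb; exists b.
  by move=> /(congr1 (@^~ z)).
pose L := [set z | forall b : {b | B b}, E (sval b z) = 0].
have cL : closed_subspace L.
  apply: (@closed_subspace_ker _ _ _ (fun b : {b | B b} => E \o sval b)).
  move=> -[b Bb].
  by apply: (vn_bop vB); exact: vn_comp.
have LB b z : B b -> L z -> L (b z).
  by move=> Bb Lz [b' Bb'] /=; exact: (Lz (exist _ _ (vn_comp vB Bb' Bb))).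
have L' S : commutant B S -> forall z, L z -> L (S z).
  move=> cS z Lz [b Bb] /=; rewrite (commutantE _ cS Bb) (commutantE _ cS BE).
  by rewrite (Lz (exist _ _ Bb)) (bop0 (commutant_bop cS)).
have [Q [[BQ QQ aQ] LQ]] := vn_projection vB cL L'.
have QL z : L (Q z) by apply/LQ; rewrite -[in RHS]QQ.
have cQ : commutant B Q.
  split; first exact: (vn_bop vB BQ).
  move=> b Bb; apply/funext => z /=.
  have bb := vn_bop vB Bb; have bQ := vn_bop vB BQ.
  have h1 : Q (b (Q z)) = b (Q z) by apply/LQ/LB.
  rewrite -h1; apply: rdot_inj => w; rewrite !(adjP _ _ bQ) aQ !(adjP _ _ bb).
  rewrite !(adjP _ _ bQ) aQ; congr rdot; apply/esym/LQ/LB => //.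
  exact: vn_adj.
have : vN_center B Q by [].
rewrite ZB => -[c _ cE]; have [z pz] := neq_cst0 p0.
have Qpz : Q (p z) = p z by apply/LQ => -[b Bb] /=; exact: Ebp.
have c1 : c = 1.
  apply/eqP; rewrite -subr_eq0; apply/eqP; apply: contrapT => c1; apply: pz.
  have /eqP : (c - 1) *: p z = 0.
    by rewrite scalerBl scale1r -[in X in _ - X]Qpz -cE subrr.
  by rewrite scaler_eq0 => /orP[] /eqP.
apply/funext => w; have /LQ Lw : Q w = w by rewrite -cE c1 /= scale1r.
exact: (Lw (exist _ _ (vn_id vB))).
Qed.

(** The partial isometry is that of the polar decomposition of some nonzero
    E b p. *)
Lemma factor_partial_isometry B E p : vN_factor B -> projection B E ->
  projection B p -> E <> cst 0 -> p <> cst 0 ->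
  exists y, [/\ B y, forall z, y (adj y (y z)) = y z, forall z, E (y z) = y z,
    forall z, y (p z) = y z & y <> cst 0].
Proof.
move=> fB pE pp E0 p0; have [vB _ _] := fB.
have [b Bb] := factor_corner fB pE pp E0 p0; set x := _ \o _ \o _ => x0.
have [BE _ aE] := pE; have [Bp _ ap] := pp.
have Bx : B x by apply: vn_comp => //; exact: vn_comp.
have bx := vn_bop vB Bx; have bE := vn_bop vB BE.
have [y [h []]] := polar bx => by_ bh ah h2 xE y'x ypi kery kery' _ vy.
exists y; split=> //; first exact: vy.
- have yE w : adj y (E w) = adj y w.
    apply/eqP; rewrite -subr_eq0 -(bopB (bop_adj by_)); apply/eqP/kery'.
    apply: rdot_inj => z; rewrite rdot0l (adjP _ _ (bop_adj bx)) adjK//.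
    by rewrite rdotBl (adjP _ _ bE) aE /x /= (projectionE pE) subrr.
  move=> z; apply: rdot_inj => w; rewrite (adjP _ _ bE) aE (adjP _ _ by_) yE.
  by rewrite (adjP _ _ by_).
- move=> z; apply/eqP; rewrite -subr_eq0 -(bopB by_); apply/eqP/kery.
  apply: rdot_eq0; rewrite (adjP _ _ bh) ah h2 (bopB bx) /x /=.
  by rewrite (projectionE pp) subrr (bop0 (bop_adj bx)) rdot0r.
- by move=> y0; apply: x0; apply/funext => z; rewrite -xE y0.
Qed.

(** Take a maximal family of nonzero partial isometries under p with orthogonal
    ranges. If the ranges do not span H, the projection E onto their complement
    is nonzero and [factor_partial_isometry] enlarges the family. By
    sigma-finiteness the family is countable; the sequence enumerates it and is
    0 at unused indices. *)
Lemma exhausting_partial_isometries B p : vN_factor B -> sigma_finite_vN B ->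
  projection B p -> p <> cst 0 ->
  exists y : nat -> H -> H,
    [/\ forall k, B (y k), forall k z, y k (adj (y k) (y k z)) = y k z,
      forall k z, y k (p z) = y k z,
      forall j k z, j != k -> adj (y j) (y k z) = 0 &
      forall z, (forall k, adj (y k) z = 0) -> z = 0].
Proof.
move=> fB sB pp p0; have [vB _ _] := fB.
pose good := [set y | [/\ B y, forall z, y (adj y (y z)) = y z,
  forall z, y (p z) = y z & y <> cst 0]].
pose orth (F : set (H -> H)) :=
  forall y y', F y -> F y' -> y <> y' -> forall z, adj y (y' z) = 0.
have [F FF totF|F [[Fg Fo] Fmax]] :=
  @Zorn_bigcup _ [set F | F `<=` good /\ orth F].
  split=> [y [X /FF[Xg _] /Xg]//|y y' [X FX Xy] [Y FY Yy']].
  have [XY|YX] := totF _ _ FX FY.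
    by apply: (FF _ FY).2 => //; exact: XY.
  by apply: (FF _ FX).2 => //; exact: YX.
have Fb y : F y -> bounded_op y by move=> /Fg[By _ _ _]; exact: (vn_bop vB).
(* Otherwise a partial isometry y0 into the complement K of the ranges could be
   added to F. *)
have Ftot z : (forall y, F y -> adj y z = 0) -> z = 0.
  move=> Fz; apply: contrapT => z0.
  pose K := [set z | forall y : {y | F y}, adj (sval y) z = 0].
  have cK : closed_subspace K.
    apply: (@closed_subspace_ker _ _ _ (fun y : {y | F y} => adj (sval y))).
    by move=> -[y Fy]; exact/bop_adj/Fb.
  have K' S : commutant B S -> forall z, K z -> K (S z).
    move=> cS w Kw [y Fy] /=; have [By _ _ _] := Fg _ Fy.
    rewrite (commutantE _ cS (vn_adj vB By)) (Kw (exist _ _ Fy)).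
    exact: bop0 (commutant_bop cS).
  have [E [pE KE]] := vn_projection vB cK K'.
  have E0 : E <> cst 0.
    move=> E0; apply: z0; have <- : E z = z by apply/KE => -[y Fy]; exact: Fz.
    by rewrite E0.
  have [y0 [By0 y0pi Ey0 y0p y00]] := factor_partial_isometry fB pE pp E0 p0.
  have y0K y w : F y -> adj y (y0 w) = 0.
    by move=> Fy; have /KE/(_ (exist _ _ Fy)) := Ey0 w.
  apply: (Fmax (F `|` [set y0])).
    split=> [|h]; first exact: subsetUl.
    have Fy0 : F y0 by apply: h; right.
    by apply: y00; apply/funext => w; rewrite -y0pi y0K// (bop0 (Fb _ Fy0)).
  split=> [y [/Fg//|->]|]; first by split.
  move=> y y' [Fy|->] [Fy'|->] yy' w; [exact: Fo|exact: y0K| |by []].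
  have b0 := vn_bop vB By0; apply: rdot_inj => v.
  rewrite rdot0l (adjP _ _ (bop_adj b0)) adjK// (adjP _ _ (Fb _ Fy')).
  by rewrite y0K// rdot0r.
have countF : countable [set y \o adj y | y in F].
  apply: sB => [_ [y Fy <-]|_ [y Fy <-] y0|_ _ [y Fy <-] [y' Fy' <-] yy'].
  - have [By ypi _ _] := Fg _ Fy; have by_ := Fb _ Fy.
    split; first exact: (vn_comp vB By (vn_adj vB By)).
      by apply/funext => z /=; rewrite ypi.
    by rewrite (adj_comp by_ (bop_adj by_)) adjK.
  - have [By ypi _ yn0] := Fg _ Fy; apply: yn0; apply/funext => z.
    by rewrite -ypi; have /(congr1 (@^~ (y z))) := y0.
  - have yy'' : y <> y' by move=> h; apply: yy'; rewrite h.
    apply/funext => z /=; rewrite (Fo _ _ Fy Fy' yy'').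
    exact: bop0 (Fb _ Fy).
have /countable_injP[f fI] := countF.
have /choice[Y YP] (k : nat) : exists y,
    (F y /\ f (y \o adj y) = k) \/
    (y = cst 0 /\ forall y', F y' -> f (y' \o adj y') <> k).
  have [[y [Fy fy]]|ny] := pselect (exists y, F y /\ f (y \o adj y) = k).
    by exists y; left.
  exists (cst 0); right; split=> // y' Fy' fy'; apply: ny; by exists y'.
exists Y; split.
- by move=> k; case: (YP k) => [[/Fg[]//]|[-> _]]; exact: vn_cst0.
- by move=> k z; case: (YP k) => [[/Fg[]//]|[-> _]].
- by move=> k z; case: (YP k) => [[/Fg[]//]|[-> _]].
- move=> j k z jk; case: (YP j) => [[Fj fj]|[-> _]]; last by rewrite adj_cst0.
  case: (YP k) => [[Fk fk]|[-> _]]; last exact: bop0 (bop_adj (Fb _ Fj)).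
  by apply: Fo => // jk'; move: jk; rewrite -fj -fk jk' eqxx.
- move=> z Yz; apply: Ftot => y Fy.
  case: (YP (f (y \o adj y))) => [[FY fY]|[_ /(_ y Fy)]//].
  set k := f _ in FY fY.
  have /(congr1 (@^~ z)) /= : Y k \o adj (Y k) = y \o adj y.
    by apply: fI => //; rewrite inE; [exists (Y k)|exists y].
  rewrite Yz (bop0 (Fb _ FY)) => yz.
  have [_ ypi _ _] := Fg _ Fy.
  by rewrite -(pi_adj (Fb _ Fy) ypi) -yz (bop0 (bop_adj (Fb _ Fy))).
Qed.

Lemma iter_adj s n : bounded_op s ->
  bounded_op (fun z => iter n s z) /\
  forall z w, rdot (iter n s z) w = rdot z (iter n (adj s) w).
Proof.
move=> bs; elim: n => [|n [bn IH]]; first by split => //; exact: bop_id.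
split; first exact: (bop_comp bs bn).
by move=> z w; rewrite iterS (adjP _ _ bs) IH -iterSr.
Qed.

(** With e = 1 - s s^*, the x_n = s^n e are partial isometries with initial
    projection e and orthogonal ranges. Let the y_k exhaust H under e. If
    n_0, n_1, ... are distinct, the sum over k of x_(n_k) y_k^* is an isometry;
    splitting the indices by a pairing function gives infinitely many
    isometries with orthogonal ranges. *)
Lemma isometry_sequence B s : vN_factor B -> sigma_finite_vN B ->
  B s -> (forall z, adj s (s z) = z) -> s \o adj s <> id ->
  exists T : nat -> H -> H,
    [/\ forall j, B (T j), forall j z, adj (T j) (T j z) = z &
      forall i j z, i != j -> adj (T i) (T j z) = 0].
Proof.
move=> fB sB Bs ss ssn; have [vB _ _] := fB.
have bs := vn_bop vB Bs; have bs' := bop_adj bs.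
pose e z := z - s (adj s z).
have Be : B e.
  by apply: (vn_sub vB (vn_id vB)); exact: (vn_comp vB Bs (vn_adj vB Bs)).
have be := vn_bop vB Be.
have ae : adj e = e.
  apply: adj_eq => // z w; rewrite rdotBl rdotBr (adjP _ _ bs) (adjP _ _ bs').
  by rewrite adjK.
have es z : e (s z) = 0 by rewrite /e ss subrr.
have se z : adj s (e z) = 0 by rewrite /e (bopB bs') ss subrr.
have ee z : e (e z) = e z by rewrite {1}/e se (bop0 bs) subr0.
have pe : projection B e by split => //; apply/funext.
have e0 : e <> cst 0.
  move=> e0; apply: ssn; apply/funext => z; apply/eqP; rewrite eq_sym -subr_eq0.
  by have /(congr1 (@^~ z)) := e0 => /= ez; apply/eqP.
have [y [By ypi ye yo ytot]] := exhausting_partial_isometries fB sB pe e0.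
have by_ k := vn_bop vB (By k).
pose x n := (fun z => iter n s z) \o e.
have Bx n : B (x n).
  apply: vn_comp => //; elim: n => [|n IH]; first exact: vn_id.
  exact: (vn_comp vB Bs IH).
have bx n := vn_bop vB (Bx n).
have ax n : adj (x n) = e \o (fun z => iter n (adj s) z).
  have [bn an] := iter_adj n bs; apply: adj_eq => // z w.
  by rewrite an (adjP _ _ be) ae.
have sn n z : iter n (adj s) (iter n s z) = z.
  by elim: n z => [//|n IH] z; rewrite iterS iterSr IH ss.
have xx n z : adj (x n) (x n z) = e z by rewrite ax /x /= sn ee.
have xo m n z : m != n -> adj (x m) (x n z) = 0.
  have xlt m' n' w : (m' < n')%N -> adj (x m') (x n' w) = 0.
    move=> mn; rewrite ax /x /= -(subnKC (ltnW mn)) iterD sn.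
    case: (n' - m')%N (subn_gt0 m' n') => [|d _]; first by rewrite mn.
    by rewrite iterS es.
  rewrite neq_ltn => /orP[|nm]; first exact: xlt.
  apply: rdot_inj => w; rewrite rdot0l (adjP _ _ (bop_adj (bx m))) adjK//.
  by rewrite (adjP _ _ (bx n)) xlt ?rdot0r.
have y'e k z : e (adj (y k) z) = adj (y k) z.
  apply: rdot_inj => w; rewrite (adjP _ _ be) ae (adjP _ _ (bop_adj (by_ k))).
  by rewrite (adjK (by_ k)) ye (adjP _ _ (bop_adj (by_ k))) (adjK (by_ k)).
pose a (j k : nat) := x (pickle (j, k)) \o adj (y k).
have aa j k : adj (a j k) = y k \o adj (x (pickle (j, k))).
  by rewrite (adj_comp (bx _) (bop_adj (by_ k))) (adjK (by_ k)).
have jkE (j j' k k' : nat) :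
    (pickle (j, k) == pickle (j', k')) = (j == j') && (k == k').
  by rewrite (inj_eq (pcan_inj pickleK)).
have oa j : orth_pis (a j).
  split.
  - by move=> k; exact/bop_comp/bop_adj.
  - move=> k z; rewrite aa /a /= xx y'e; congr (x _).
    exact: pi_adj (by_ k) (ypi k) z.
  - by move=> k l z kl; rewrite aa /a /= xo ?(bop0 (by_ k))// jkE eqxx.
  - by move=> k l z kl; rewrite aa /a /= yo// (bop0 (bx _)).
have /choice[T TP] j := sot_sum_exists (oa j).
exists T; split.
- move=> j; apply: (vn_sum (TP j).1 vB) => k.
  exact: (vn_comp vB (Bx _) (vn_adj vB (By k))).
- move=> j; apply: (sot_sum_isometry (oa j) (TP j).1 (TP j).2) => z az.
  apply: ytot => k; have /(congr1 (adj (x (pickle (j, k))))) := az k.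
  by rewrite /a /= xx y'e (bop0 (bop_adj (bx _))).
- move=> i j z ij; apply: (sot_sum_ker (TP i).2) => k.
  rewrite -[RHS]/(cst 0 (T j z)); apply: (bop_sum_eq (TP j).1).
  + exact/bop_adj/(opi_bop (oa i)).
  + exact: bop_cst0.
  + by move=> l; rewrite aa /a /= xo ?(bop0 (by_ k))// jkE negb_and ij.
Qed.

End Factor.

(** * Generation by unitaries and the Cantor-Bernstein theorem *)

Section UnitariesAndEquivalence.
Context {R : realType} {H : hilbertType R}.
Implicit Types (p P t u v n b S U : H -> H) (z w : H) (A B M : set (H -> H)).

Lemma halfD z : (2^-1)%:C *: (z + z) = z.
Proof.
rewrite scalerDr -scalerDl -rmorphD /= (_ : 2^-1 + 2^-1 = 1) ?scale1r//.
by field.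
Qed.

(** b is the mean of u = b + i c and u^* = b - i c with c^2 = 1 - b^2, which are
    unitary since b and c commute. *)
Lemma unitary_contraction A B : von_neumann A -> von_neumann B ->
  (forall u, unitary_in B u -> A u) ->
  forall b, B b -> adj b = b -> (forall z, nrm (b z) <= nrm z) -> A b.
Proof.
move=> vA vB uA b Bb ab b1; have bb := vn_bop vB Bb.
have b2 := bop_comp bb bb.
have [|z|y [by_ ay yE cy]] := contraction_sqrt b2.
  by rewrite (adj_comp bb bb) ab.
  exact: le_trans (b1 _) (b1 _).
have By : B y.
  apply: (vn_bicommutant vB by_) => S cS.
  apply: cy (commutant_bop cS) _ => z.
  by rewrite /= !(commutantE _ cS Bb).
pose c z := z - y z.
have Bc : B c by exact: (@vn_sub _ _ _ vB id y (vn_id vB) By).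
have bc := vn_bop vB Bc.
have ac : adj c = c.
  by apply: adj_eq => // z w; rewrite rdotBl rdotBr (adjP _ _ by_) ay.
have cb z : c (b z) = b (c z) by rewrite /c (bopB bb) cy.
have cc z : c (c z) + b (b z) = z.
  rewrite /c (bopB by_) opprB addrACA -opprD yE.
  by rewrite opprD addrACA subrr addr0 subrK.
pose i : R[i] := 'i%C.
have ii : i * i = -1 by rewrite -expr2 sqr_i.
have ai : Num.conj i = - i by apply/eqP; rewrite eq_complex /= oppr0 !eqxx.
pose u := b \+ i \*: c.
have bic : bounded_op (i \*: c) by exact: bop_scale.
have Bu : B u by exact: (vn_add vB Bb (vn_scale vB _ Bc)).
have bu := vn_bop vB Bu.
have au : adj u = b \+ (- i) \*: c.
  by rewrite /u (adj_add bb bic) (adj_scale _ bc) ab ac ai.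
have uu : unitary_in B u.
  have inz (z : H) : i *: ((- i) *: z) = z.
    by rewrite scalerA mulrN ii opprK scale1r.
  have niz (z : H) : (- i) *: (i *: z) = z.
    by rewrite scalerA mulNr ii opprK scale1r.
  split=> //; rewrite au /u; apply/funext => z /=.
    rewrite (bopD bb) (bopD bc) (bopZ bb) (bopZ bc) cb scalerDr niz.
    by rewrite scaleNr addrA addrK addrC cc.
  rewrite (bopD bb) (bopD bc) (bopZ bb) (bopZ bc) cb scalerDr.
  by rewrite inz scaleNr addrA subrK addrC cc.
have Au := uA _ uu.
have := vn_scale vA (2^-1)%:C (vn_add vA Au (vn_adj vA Au)).
congr A; apply/funext => z; rewrite au /u /=.
by rewrite addrACA scaleNr subrr addr0 halfD.
Qed.

Lemma vn_generated_by_unitaries A B : von_neumann A -> von_neumann B ->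
  (forall u, unitary_in B u -> A u) -> B `<=` A.
Proof.
move=> vA vB uA.
have saA b : B b -> adj b = b -> A b.
  move=> Bb ab; have bb := vn_bop vB Bb; have [C C0 bC] := bop_bound bb.
  have Cn : C%:C != 0 :> R[i] by apply/eqP => -[] /eqP; rewrite gt_eqF.
  have -> : b = C%:C \*: (C^-1%:C \*: b).
    apply/funext => z; rewrite /= scalerA -rmorphM mulfV ?gt_eqF//.
    by rewrite rmorph1 scale1r.
  apply: (vn_scale vA); apply: (unitary_contraction vA vB uA).
  - exact: vn_scale.
  - have rC : Num.conj (C^-1%:C) = C^-1%:C by exact: conjc_real.
    by rewrite (adj_scale _ bb) rC ab.
  - have Ci : 0 <= C^-1 by rewrite invr_ge0 ltW.
    by move=> z; rewrite nrmRpos// ler_pdivrMl.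
move=> b Bb; have bb := vn_bop vB Bb; have bb' := bop_adj bb.
have Bb' := vn_adj vB Bb.
pose i : R[i] := 'i%C.
have ii : i * i = -1 by rewrite -expr2 sqr_i.
have ai : Num.conj i = - i by apply/eqP; rewrite eq_complex /= oppr0 !eqxx.
have Are : A (b \+ adj b).
  apply: saA; first exact: vn_add.
  by rewrite (adj_add bb bb') (adjK bb); apply/funext => z /=; rewrite addrC.
have Aim : A (i \*: b \+ (- i) \*: adj b).
  apply: saA; first by apply: (vn_add vB); exact: vn_scale.
  rewrite (adj_add (bop_scale _ bb) (bop_scale _ bb')) !adj_scale// (adjK bb).
  by rewrite ai rmorphN /= ai opprK; apply/funext => z /=; rewrite addrC.
have := vn_scale vA (2^-1)%:C (vn_add vA Are (vn_scale vA (- i) Aim)).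
congr A; apply/funext => z /=.
rewrite [(- i) *: (_ + _)]scalerDr !scalerA mulNr mulrNN ii opprK.
rewrite scale1r scaleN1r.
by rewrite addrACA subrr addr0 halfD.
Qed.

(** Let G be the sum of the projections t^k (1 - P) (t^k)^*. Then u, equal to t
    on the range of G and to 1 on its complement, shifts the first summand 1 - P
    away, so that its range is that of P. The projection F = 1 - G is obtained
    without summation: its range consists of the vectors that all powers of t^*
    map into the range of P. *)
Lemma cantor_bernstein B P t : von_neumann B -> projection B P -> B t ->
  (forall z, adj t (t z) = z) -> (forall z, P (t z) = t z) ->
  exists u, [/\ B u, forall z, adj u (u z) = z & forall z, u (adj u z) = P z].
Proof.
move=> vB pP Bt tt Pt; have [BP _ aP] := pP; have PP := projectionE pP.
have bP := vn_bop vB BP; have bt := vn_bop vB Bt; have bt' := bop_adj bt.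
have t'P z : adj t (P z) = adj t z.
  apply: rdot_inj => w; rewrite !(adjP _ _ bt') (adjK bt) (adjP _ _ bP) aP Pt.
  by [].
pose d k z := iter k (adj t) z - P (iter k (adj t) z).
have Bd k : B (d k).
  have Bk : B (fun z => iter k (adj t) z).
    elim: k => [|k IH]; first exact: vn_id.
    exact: (vn_comp vB (vn_adj vB Bt) IH).
  exact: (vn_sub vB Bk (vn_comp vB BP Bk)).
pose K := [set z | forall k, d k z = 0].
have cK : closed_subspace K.
  by apply: (@closed_subspace_ker _ _ _ d) => k; exact: (vn_bop vB (Bd k)).
have K' S : commutant B S -> forall z, K z -> K (S z).
  move=> cS z Kz k; rewrite (commutantE _ cS (Bd k)) Kz.
  exact: bop0 (commutant_bop cS).
have [F [pF KF]] := vn_projection vB cK K'.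
have [BF _ aF] := pF; have FF := projectionE pF; have bF := vn_bop vB BF.
have KFz z : K (F z) by apply/KF.
have KP z : K z -> P z = z by move=> /(_ 0)/eqP; rewrite subr_eq0 => /eqP.
have Kt z : K z -> K (adj t z).
  by move=> Kz k; have := Kz k.+1; rewrite /d iterSr.
have tK z : P z = z -> K (adj t z) -> K z.
  move=> Pz Kz [|k]; first by rewrite /d /= Pz subrr.
  by have := Kz k; rewrite /d -iterSr.
(* G = (1 - P) + t G t^*, written for F = 1 - G. *)
pose E z := P z - t (adj t z) + t (F (adj t z)).
have FE z : F z = E z.
  have EK w : K w -> E w = w.
    move=> Kw; rewrite /E (KP _ Kw); have /KF -> := Kt _ Kw.
    by rewrite subrK.
  have KE w : K (E w).
    apply: tK; first by rewrite /E (bopD bP) (bopB bP) PP !Pt.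
    rewrite /E (bopD bt') (bopB bt') t'P !tt subrr add0r; exact: KFz.
  have aE z' w : rdot (E z') w = rdot z' (E w).
    rewrite /E !rdotDl !rdotDr !rdotNl !rdotNr (adjP _ _ bP) aP.
    rewrite !(adjP _ _ bt) !(adjP _ _ bF) aF !(adjP _ _ bt') (adjK bt).
    by [].
  apply: rdot_inj => w; rewrite (adjP _ _ bF) aF -[F w]EK// -aE.
  by rewrite -{1}aF -(adjP _ _ bF) (KF _).1.
have Ft z : F (t z) = t (F z) by rewrite FE /E Pt !tt subrr add0r.
have t'F z : adj t (F z) = F (adj t z).
  apply: rdot_inj => w; rewrite (adjP _ _ bt') (adjK bt) !(adjP _ _ bF) aF Ft.
  by rewrite (adjP _ _ bt') (adjK bt).
pose u z := t (z - F z) + F z.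
have Bu : B u.
  exact: (vn_add vB (vn_comp vB Bt (vn_sub vB (vn_id vB) BF)) BF).
have bu := vn_bop vB Bu.
have au : adj u = fun z => adj t z - F (adj t z) + F z.
  apply: adj_eq => // z w; rewrite /u !rdotDl !rdotDr rdotNr (adjP _ _ bt).
  by rewrite rdotBl !(adjP _ _ bF) aF.
exists u; split=> // z; rewrite au /u.
  set w := t _ + _.
  have tw : adj t w = z - F z + F (adj t z) by rewrite (bopD bt') tt t'F.
  have Ftw : F (adj t w) = F (adj t z).
    by rewrite tw (bopD bF) (bopB bF) !FF subrr add0r.
  have Fw : F w = F z.
    by rewrite (bopD bF) Ft (bopB bF) !FF subrr (bop0 bt) add0r.
  by rewrite Ftw Fw tw addrK subrK.
set w := _ - _ + _.
have Fw : F w = F z by rewrite (bopD bF) (bopB bF) !FF subrr add0r.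
rewrite Fw addrK (bopB bt) (FE z) /E.
by rewrite addrC addrA addrAC addrK subrK.
Qed.
End UnitariesAndEquivalence.

(** * Groupoid normalisers *)

Section Amplification.
Context {R : realType} {H : hilbertType R}.
Implicit Types (p P t u v n b S U : H -> H) (z w : H) (A B M : set (H -> H)).

Lemma normaliserP M B n : normaliser M B n <->
  M n /\ forall b, B b -> B (n \o b \o adj n) /\ B (adj n \o b \o n).
Proof.
split=> [[Mn nB]|[Mn nB]]; split=> //.
  by move=> b Bb; split; apply: nB; [left|right]; exists b.
by move=> _ [[b Bb <-]|[b Bb <-]]; case: (nB b Bb).
Qed.

Lemma sigma_finite_sub M B : B `<=` M -> sigma_finite_vN M -> sigma_finite_vN B.
Proof.
move=> BM sM F FB; apply: sM => p /FB[Bp pp ap]; split=> //; exact: BM.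
Qed.

(** 1 is a nonzero central projection, so it is not finite. *)
Lemma type_II_infty_isometry B : vN_factor B -> type_II_infty B ->
  exists s, [/\ B s, forall z, adj s (s z) = z & s \o adj s <> id].
Proof.
move=> [vB _ id0] [_ finB]; apply: contrapT => ns; apply: id0; apply: finB.
  split; first by split; [exact: vn_id| |exact: adj_id].
  move=> q _ _ [s [Bs ss sq]]; apply: contrapT => q1; apply: ns.
  by exists s; split=> // [z|]; [rewrite -[RHS]/(id z) -ss|rewrite sq].
split; first exact: vn_id.
by split; [exact: bop_id|].
Qed.

Section Amplify.
Variables (B : set (H -> H)) (T : nat -> H -> H).
Hypotheses (fB : vN_factor B) (sB : sigma_finite_vN B).
Hypotheses (BT : forall j, B (T j)) (TT : forall j z, adj (T j) (T j z) = z).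
Hypothesis To : forall i j z, i != j -> adj (T i) (T j z) = 0.

Let vB : von_neumann B. Proof. by case: fB. Qed.
Let bT j : bounded_op (T j). Proof. exact: (vn_bop vB (BT j)). Qed.
Let bT' j : bounded_op (adj (T j)). Proof. exact: (bop_adj (bT j)). Qed.

Definition amplification v k := T k \o v \o adj (T k).

Lemma amplification_adj v k : bounded_op v ->
  adj (amplification v k) = amplification (adj v) k.
Proof.
move=> bv; rewrite /amplification (adj_comp (bop_comp (bT k) bv) (bT' k)).
by rewrite (adj_comp (bT k) bv) (adjK (bT k)).
Qed.

Lemma amplification_orth_pis v : bounded_op v ->
  (forall z, v (adj v (v z)) = v z) -> orth_pis (amplification v).
Proof.
move=> bv vpi; have bv' := bop_adj bv; split=> [k|k z|j k z jk|j k z jk].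
- exact: (bop_comp (bop_comp (bT k) bv) (bT' k)).
- by rewrite (amplification_adj _ bv) /amplification /= !TT vpi.
- rewrite (amplification_adj _ bv) /amplification /= To//.
  by rewrite (bop0 bv') (bop0 (bT j)).
- rewrite (amplification_adj _ bv) /amplification /= To//.
  by rewrite (bop0 bv) (bop0 (bT j)).
Qed.

(** Let the y_k exhaust H under v^* v. The sum t of the T_k y_k^* is an isometry
    in B, and its range is below S^* S because T_k maps the initial space of v
    into that of S. [cantor_bernstein] makes the range equal to S^* S. *)
Lemma amplified_support v S : bounded_op v ->
  (forall z, v (adj v (v z)) = v z) -> v <> cst 0 -> B (adj v \o v) ->
  sot_sum (amplification v) S ->
  sot_sum (fun k => adj (amplification v k)) (adj S) ->
  B (adj S \o S) ->
  exists u, [/\ B u, forall z, adj u (u z) = z &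
    forall z, u (adj u z) = adj S (S z)].
Proof.
move=> bv vpi v0 Bp aS aS' BP; have bv' := bop_adj bv.
have oa := amplification_orth_pis bv vpi; have oa' := orth_pis_adj oa.
have bS := aS.1; have bS' := bop_adj bS.
have pp : projection B (adj v \o v).
  split=> //; first by apply/funext => z /=; rewrite vpi.
  by rewrite (adj_comp bv' bv) (adjK bv).
have p0 : adj v \o v <> cst 0.
  move=> p0; apply: v0; apply/funext => z.
  by rewrite -vpi; have /(congr1 (@^~ z)) := p0 => /= ->; rewrite (bop0 bv).
have pP : projection B (adj S \o S).
  split=> //; first by apply/funext => z /=; rewrite (sot_sum_pi oa aS aS').
  by rewrite (adj_comp bS' bS) (adjK bS).
have [y [By ypi yp yo ytot]] := exhausting_partial_isometries fB sB pp p0.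
have by_ k := vn_bop vB (By k); have by' k := bop_adj (by_ k).
have py k z : adj v (v (adj (y k) z)) = adj (y k) z.
  apply: rdot_inj => w; rewrite (adjP _ _ bv') (adjK bv) (adjP _ _ bv).
  by rewrite !(adjP _ _ (by' k)) (adjK (by_ k)) yp.
pose c k := T k \o adj (y k).
have c' k : adj (c k) = y k \o adj (T k).
  by rewrite (adj_comp (bT k) (by' k)) (adjK (by_ k)).
have oc : orth_pis c.
  split=> [k|k z|j k z jk|j k z jk]; rewrite ?c' /c /=.
  - exact: (bop_comp (bT k) (by' k)).
  - by rewrite TT (pi_adj (by_ k) (ypi k)).
  - by rewrite To// (bop0 (by_ j)).
  - by rewrite yo// (bop0 (bT j)).
have [t [ct ct']] := sot_sum_exists oc; have bt := ct.1.
have Bt : B t.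
  apply: (vn_sum ct vB) => k.
  exact: (vn_comp vB (BT k) (vn_adj vB (By k))).
apply: (cantor_bernstein vB pP Bt).
  apply: (sot_sum_isometry oc ct ct') => z cz; apply: ytot => k.
  by have := congr1 (adj (T k)) (cz k); rewrite /c /= TT (bop0 (bT' k)).
move=> z; apply: (bop_sum_eq ct (T := adj S \o S) (T' := id)).
- exact: bop_comp.
- exact: bop_id.
- move=> k; rewrite /c /=; set x := adj (y k) z.
  have Tx : T k x = adj (amplification v k) (T k (v x)).
    by rewrite (amplification_adj _ bv) /amplification /= TT py.
  rewrite {1}Tx (sot_sum_adj_mem oa aS) (sot_sum_mem oa aS aS') -Tx.
  by rewrite (amplification_adj _ bv) /amplification /= !TT py.
Qed.

Lemma amplification_corner v S : bounded_op v -> sot_sum (amplification v) S ->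
  forall z, adj (T 0) (S (T 0 z)) = v z.
Proof.
move=> bv [bS SP] z; rewrite -[RHS](TT 0); congr (adj _ _).
apply: tends_unique (SP _) _.
apply: (tends_eventually (N := 1)) (tends_const _) => n n0.
rewrite (psum_single (k := 0))// /amplification /= ?TT// => j j0.
by rewrite To// (bop0 bv) (bop0 (bT j)).
Qed.

(** S b S^* is in B although S need not be, since all the
    T_j v (T_j^* b T_k) v^* T_k^* are. The isometries u and w of B carry 1 onto
    the initial and final projections of S, so that w^* S u is unitary. *)
Lemma groupoid_normaliser_generated M A v : von_neumann M -> B `<=` M ->
  von_neumann A -> unitary_normaliser M B `<=` A -> B `<=` A ->
  groupoid_normaliser M B v -> A v.
Proof.
move=> vM BM vA uA BA [/normaliserP[Mv vBv] vpi0].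
have [->|v0] := pselect (v = cst 0); first exact: vn_cst0.
have bv := vn_bop vM Mv; have bv' := bop_adj bv.
have vpi z : v (adj v (v z)) = v z by rewrite -[in RHS]vpi0.
have oa := amplification_orth_pis bv vpi; have oa' := orth_pis_adj oa.
have [S [aS aS']] := sot_sum_exists oa; have bS := aS.1; have bS' := bop_adj bS.
have Spi := sot_sum_pi oa aS aS'.
have aS1 : sot_sum (amplification (adj v)) (adj S).
  have := aS'; congr sot_sum; apply/funext => k; exact: amplification_adj.
have aS1' : sot_sum (fun k => adj (amplification (adj v) k)) (adj (adj S)).
  rewrite (adjK bS); have := aS; congr sot_sum; apply/funext => k.
  by rewrite (amplification_adj _ bv') (adjK bv).
have SBS b : B b -> B (S \o b \o adj S).
  move=> Bb; apply: (vn_sum_conj vB oa aS) Bb => j k {}b Bb.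
  rewrite (amplification_adj _ bv).
  have := vn_comp vB (vn_comp vB (BT j)
    (vBv _ (vn_comp vB (vn_comp vB (vn_adj vB (BT j)) Bb) (BT k))).1)
    (vn_adj vB (BT k)).
  by [].
have S'BS b : B b -> B (adj S \o b \o S).
  move=> Bb; have := vn_sum_conj vB oa' aS'; rewrite (adjK bS); apply=> //.
  move=> j k {}b {}Bb; rewrite (adjK (opi_bop oa k)) (amplification_adj _ bv).
  have := vn_comp vB (vn_comp vB (BT j)
    (vBv _ (vn_comp vB (vn_comp vB (vn_adj vB (BT j)) Bb) (BT k))).2)
    (vn_adj vB (BT k)).
  by [].
have MS : M S.
  apply: (vn_sum aS vM) => k; rewrite /amplification.
  apply: (vn_comp vM); last exact: (BM _ (vn_adj vB (BT k))).
  by apply: (vn_comp vM) => //; exact: (BM _ (BT k)).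
have [u [Bu uu uP]] : exists u, [/\ B u, forall z, adj u (u z) = z &
    forall z, u (adj u z) = adj S (S z)].
  apply: (amplified_support bv vpi v0) => //; first exact: (vBv _ (vn_id vB)).2.
  exact: (S'BS _ (vn_id vB)).
have [w [Bw ww wP]] : exists u, [/\ B u, forall z, adj u (u z) = z &
    forall z, u (adj u z) = adj (adj S) (adj S z)].
  apply: (amplified_support bv' _ _ _ aS1 aS1').
  - by move=> z; rewrite (adjK bv) (pi_adj bv vpi).
  - by move=> v'0; apply: v0; rewrite -(adjK bv) v'0 adj_cst0.
  - by rewrite (adjK bv); exact: (vBv _ (vn_id vB)).1.
  - by rewrite (adjK bS); exact: (SBS _ (vn_id vB)).
rewrite (adjK bS) in wP.
have bu := vn_bop vB Bu; have bw := vn_bop vB Bw.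
have bu' := bop_adj bu; have bw' := bop_adj bw.
pose U := adj w \o S \o u.
have MU : M U.
  apply: (vn_comp vM); last exact: BM.
  by apply: (vn_comp vM) => //; exact: (BM _ (vn_adj vB Bw)).
have aU : adj U = adj u \o adj S \o w.
  by rewrite (adj_comp (bop_comp bw' bS) bu) (adj_comp bw' bS) (adjK bw).
have UU z : adj U (U z) = z by rewrite aU /U /= wP Spi -uP !uu.
have UU' z : U (adj U z) = z.
  by rewrite aU /U /= uP (pi_adj bS Spi) -wP !ww.
have UBU b : B b -> B (U \o b \o adj U).
  move=> Bb; rewrite aU.
  have := vn_comp vB (vn_comp vB (vn_adj vB Bw)
    (SBS _ (vn_comp vB (vn_comp vB Bu Bb) (vn_adj vB Bu)))) Bw.
  by [].
have U'BU b : B b -> B (adj U \o b \o U).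
  move=> Bb; rewrite aU.
  have := vn_comp vB (vn_comp vB (vn_adj vB Bu)
    (S'BS _ (vn_comp vB (vn_comp vB Bw Bb) (vn_adj vB Bw)))) Bu.
  by [].
have AU : A U.
  apply: uA; split; first by split=> //; apply/funext.
  apply/seteqP; split=> [_ [b Bb <-]|b Bb]; first exact: UBU.
  exists (adj U \o b \o U); first exact: U'BU.
  by apply/funext => z /=; rewrite !UU'.
have AS : A S.
  have := vn_comp vA (vn_comp vA (BA _ Bw) AU) (vn_adj vA (BA _ Bu)).
  congr A; apply/funext => z; rewrite /U /=.
  by rewrite wP uP !Spi.
have := vn_comp vA (vn_comp vA (vn_adj vA (BA _ (BT 0))) AS) (BA _ (BT 0)).
by congr A; apply/funext => z; exact: (amplification_corner bv aS z).
Qed.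

End Amplify.

(** [vn_sandwich] removes the factors n n^* from
    n n^* (v b v^* ) n n^* = n (h b h) n^* and the factors h from
    h (v^* b v) h = n^* b n. *)
Lemma polar_groupoid_normaliser M B n v h : von_neumann M -> von_neumann B ->
  normaliser M B n -> polar_decomposition n v h ->
  B h /\ groupoid_normaliser M B v.
Proof.
move=> vM vB /normaliserP[Mn nBn] pd; have bn := vn_bop vM Mn.
have bn' := bop_adj bn; have bv := polar_bop pd; have bv' := bop_adj bv.
have Bh : B h by apply: (polar_abs_vn pd vB); exact: (nBn _ (vn_id vB)).2.
split=> //; split; last by apply/funext => z; exact: (polar_pi pd z).
apply/normaliserP; split=> [|b Bb]; first exact: (polar_vn pd vM Mn).
have bb := vn_bop vB Bb; have bb' := bop_adj bb.
have ah := polar_abs_sa pd; have bh := polar_abs_bop pd.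
have n'v z : adj n (v z) = h z.
  apply: rdot_inj => w; rewrite (adjP _ _ bn') (adjK bn) (adjP _ _ bv).
  by rewrite (polar_adjE pd) (adjP _ _ bh) ah.
have hv' z : h (adj v z) = adj n z.
  apply: rdot_inj => w; rewrite (adjP _ _ bh) ah (adjP _ _ bv') (adjK bv).
  by rewrite (polarE pd) (adjP _ _ bn') (adjK bn).
have n'0 z : n (adj n z) = 0 -> adj v z = 0.
  move=> nz; apply: (polar_adj_ker pd); apply: rdot_eq0.
  by rewrite (adjP _ _ bn') (adjK bn) nz rdot0r.
split.
- apply: (vn_sandwich (A := n \o adj n) vB).
  + exact: (nBn _ (vn_id vB)).1.
  + by rewrite (adj_comp bn bn') (adjK bn).
  + exact: (bop_comp (bop_comp bv bb) bv').
  + by move=> z /= /n'0 ->; rewrite (bop0 bb) (bop0 bv).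
  + move=> z /= /n'0 z0.
    rewrite (adj_comp (bop_comp bv bb) bv') (adj_comp bv bb) (adjK bv) /= z0.
    by rewrite (bop0 bb') (bop0 bv).
  + have := (nBn _ (vn_comp vB (vn_comp vB Bh Bb) Bh)).1.
    by congr B; apply/funext => z /=; rewrite n'v (polar_adjE pd).
- apply: (vn_sandwich (A := h) vB Bh ah).
  + exact: (bop_comp (bop_comp bv' bb) bv).
  + by move=> z /= /(polar_ker pd) ->; rewrite (bop0 bb) (bop0 bv').
  + move=> z /= /(polar_ker pd) z0.
    rewrite (adj_comp (bop_comp bv' bb) bv) (adj_comp bv' bb) (adjK bv) /= z0.
    by rewrite (bop0 bb') (bop0 bv').
  + have := (nBn _ Bb).2.
    by congr B; apply/funext => z /=; rewrite (polarE pd) hv'.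
Qed.

End Amplification.

Theorem theorem3p16 (R : realType) (H : hilbertType R) (M B : set (H -> H))
    (factorM : vN_factor M) (typeM : type_II_infty M)
    (sigma_finiteM : sigma_finite_vN M)
    (factorB : vN_factor B) (typeB : type_II_infty B) (subBM : B `<=` M) :
  (Wstar M (normaliser M B) = Wstar M (groupoid_normaliser M B) /\
   Wstar M (groupoid_normaliser M B) = Wstar M (unitary_normaliser M B)) /\
  (regular_in M B <-> unitary_regular_in M B).
Proof.
have [vM _ _] := factorM; have [vB _ _] := factorB.
have UG : unitary_normaliser M B `<=` groupoid_normaliser M B.
  move=> u [[Mu uu uu'] uB]; split; last by rewrite uu'.
  apply/normaliserP; split=> // b Bb; split; first by rewrite -uB; exists b.
  have : [set u \o b \o adj u | b in B] b by rewrite uB.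
  move=> [b' Bb' <-]; have := Bb'; congr B; apply/funext => z /=.
  by rewrite -[RHS]/((adj u \o u) (b' ((adj u \o u) z))) uu.
have NA A : von_neumann A -> unitary_normaliser M B `<=` A ->
    normaliser M B `<=` A.
  move=> vA uA.
  have BA : B `<=` A.
    apply: vn_generated_by_unitaries => // u [Bu uu uu']; apply: uA.
    split; first by split=> //; exact: subBM.
    apply/seteqP; split=> [_ [b Bb <-]|b Bb].
      exact: (vn_comp vB (vn_comp vB Bu Bb) (vn_adj vB Bu)).
    exists (adj u \o b \o u).
      exact: (vn_comp vB (vn_comp vB (vn_adj vB Bu) Bb) Bu).
    apply/funext => z.
    by rewrite -[LHS]/((u \o adj u) (b ((u \o adj u) z))) uu'.
  have sB := sigma_finite_sub subBM sigma_finiteM.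
  have [s [Bs ss ss']] := type_II_infty_isometry factorB typeB.
  have [T [BT TT To]] := isometry_sequence factorB sB Bs ss ss'.
  move=> n nN; have [v [h pd]] := polar (vn_bop vM nN.1).
  have [Bh gv] := polar_groupoid_normaliser vM vB nN pd.
  have Av : A v.
    exact: (groupoid_normaliser_generated factorB sB BT TT To vM subBM vA uA).
  have := vn_comp vA Av (BA _ Bh); congr A.
  by apply/funext => z; exact: (polarE pd z).
have Wsub S S' : (forall A, von_neumann A -> S' `<=` A -> S `<=` A) ->
    Wstar M S `<=` Wstar M S'.
  by move=> SS' x Wx A [[vA AM] S'A]; apply: Wx; split=> //; exact: SS'.
have GN : groupoid_normaliser M B `<=` normaliser M B by move=> v [].
have NU : Wstar M (normaliser M B) = Wstar M (unitary_normaliser M B).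
  apply/seteqP; split; apply: Wsub => // A _ NA'.
  exact: subset_trans UG (subset_trans GN NA').
have NG : Wstar M (normaliser M B) = Wstar M (groupoid_normaliser M B).
  apply/seteqP; split; apply: Wsub => A vA; last exact: subset_trans.
  by move=> GA; apply: (NA _ vA); exact: subset_trans GA.
by split; [rewrite -NG|rewrite /regular_in /unitary_regular_in NU].
Qed.
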